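(* Let $p\in[1,\infty)$, $q\in[1,\infty]$, $p\ne q$ and $0<s<1/p$. Let $\mathbb{B}^s_{p,q}$ be the Besov space of $[0,1]$ (with the usual metric and Lebesgue measure). There are quasisymmetric grids $\mathcal{P}_\star$ of $[0,1]$ such that $\mathcal{B}^s_{p,q}(\mathcal{P}_\star)\ne\mathbb{B}^s_{p,q}$.
   Context: $|S|$ is Lebesgue measure on $[0,1]$. A good grid of $[0,1]$ by intervals is a sequence $\mathcal{P}=(\mathcal{P}^k)_{k\ge0}$ of finite families of intervals of positive length such that every $\mathcal{P}^k$ is a partition of $[0,1]$ up to sets of zero measure, every element of $\mathcal{P}^{k+1}$ is contained in an element of $\mathcal{P}^k$, $\bigcup_k\mathcal{P}^k$ generates the Borel $\sigma$-algebra (up to null sets), and there are $\lambda,\hat\lambda\in(0,1)$ with $\hat\lambda\le|Q|/|P|\le\lambda$ whenever $Q\subset P$, $Q\in\mathcal{P}^{k+1}$, $P\in\mathcal{P}^k$. It is a quasisymmetric grid if moreover there is $C\ge1$ with $\frac1C\le|Q|/|P|\le C$ for every $k\ge0$ and $P,Q\in\mathcal{P}^k$ with $\overline P\cap\overline Q\ne\emptyset$. For $Q\in\bigcup_k\mathcal{P}^k$ let $a_Q=|Q|^{s-1/p}1_Q$. $\mathcal{B}^s_{p,q}(\mathcal{P})$ is the space of $f\in L^p([0,1])$ that can be written as $f=\sum_{k\ge0}\sum_{Q\in\mathcal{P}^k}s_Qa_Q$ with $s_Q\in\mathbb{C}$, the series over $k$ converging absolutely in $L^p$ (i.e. $\sum_k|\sum_{Q\in\mathcal{P}^k}s_Qa_Q|_{L^p}<\infty$),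 and $\big(\sum_k(\sum_{Q\in\mathcal{P}^k}|s_Q|^p)^{q/p}\big)^{1/q}<\infty$ (supremum over $k$ if $q=\infty$). The Besov space $\mathbb{B}^s_{p,q}$ of $[0,1]$ is $\mathcal{B}^s_{p,q}(\mathcal{D})$, where $\mathcal{D}$ is the dyadic grid $\mathcal{D}^k=\{[j2^{-k},(j+1)2^{-k}]:0\le j<2^k\}$. *)

(* Defs.v *)
From mathcomp Require Import all_boot all_order all_algebra.
From mathcomp Require Import all_classical all_reals all_analysis.
From mathcomp Require Import complex.

Set Implicit Arguments.
Unset Strict Implicit.
Unset Printing Implicit Defensive.

Import Order.TTheory GRing.Theory Num.Theory.
Import numFieldNormedType.Exports.

Local Open Scope classical_set_scope.
Local Open Scope ring_scope.
Local Open Scope complex_scope.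

Definition unit_itv (R : realType) : set R := `[0, 1]%classic.
Arguments unit_itv : clear implicits.

(* |Q|; only applied to subsets of [0, 1], where the measure is finite. *)
Definition len (R : realType) (Q : set R) : R := fine (lebesgue_measure Q).

(* [P k] is the k-th family. It is a set of intervals rather than an indexed
   family: a.e. disjoint intervals of positive length cannot be repeated. *)
Record good_grid (R : realType) (P : nat -> set (set R)) : Prop := GoodGrid {
  grid_finite : forall k, finite_set (P k) ;
  grid_interval : forall k Q, P k Q ->
    [/\ is_interval Q, Q `<=` unit_itv R & 0 < len Q] ;
  grid_disjoint : forall k Q Q', P k Q -> P k Q' -> Q <> Q' ->
    lebesgue_measure (Q `&` Q') = 0%E ;
  grid_cover : forall k,
    lebesgue_measure (unit_itv R `\` \bigcup_(Q in P k) Q) = 0%E ;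
  grid_nested : forall k Q, P k.+1 Q -> exists2 Q', P k Q' & Q `<=` Q' ;
  grid_generates : forall B : set R, measurable B -> B `<=` unit_itv R ->
    exists2 A, <<s unit_itv R, \bigcup_k P k >> A &
      lebesgue_measure (B `+` A) = 0%E ;
  grid_ratio : exists lmin lmax : R,
    [/\ 0 < lmin < 1, 0 < lmax < 1 &
      forall k Q Q', P k.+1 Q -> P k Q' -> Q `<=` Q' ->
        lmin <= len Q / len Q' <= lmax] }.

Definition quasisymmetric_grid (R : realType) (P : nat -> set (set R)) : Prop :=
  good_grid P /\
  exists2 C : R, 1 <= C & forall k Q Q', P k Q -> P k Q' ->
    closure Q `&` closure Q' !=set0 -> C^-1 <= len Q' / len Q <= C.

Definition dyadic_grid (R : realType) (k : nat) : set (set R) :=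
  [set Q | exists2 j : nat, (j < 2 ^ k)%N &
    Q = `[j%:R * 2 ^- k, j.+1%:R * 2 ^- k]%classic].
Arguments dyadic_grid : clear implicits.

Definition Lp_norm (R : realType) (p : R) (f : R -> R[i]) : \bar R :=
  'N[lebesgue_measure]_p%:E [ (fun x => (Normc.normc (f x))%:E) \_ (unit_itv R) ]%E.

(* Elements of L^p([0, 1]) are represented by functions, whose values outside
   [0, 1] are irrelevant. *)
Definition in_Lp (R : realType) (p : R) (f : R -> R[i]) : Prop :=
  [/\ measurable_fun (unit_itv R) (fun x => complex.Re (f x)),
      measurable_fun (unit_itv R) (fun x => complex.Im (f x)) &
      (Lp_norm p f < +oo)%E].

Definition atom (R : realType) (s p : R) (Q : set R) (x : R) : R[i] :=
  (len Q `^ (s - p^-1) * \1_Q x)%:C.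

Definition level (R : realType) (s p : R) (P : nat -> set (set R))
    (c : set R -> R[i]) (k : nat) (x : R) : R[i] :=
  \sum_(Q \in P k) c Q * atom s p Q x.

Definition coef_norm (R : realType) (p : R) (q : \bar R)
    (P : nat -> set (set R)) (c : set R -> R[i]) : \bar R :=
  let S k := \sum_(Q \in P k) Normc.normc (c Q) `^ p in
  match q with
  | r%:E => ((\sum_(0 <= k <oo) (S k `^ (r / p))%:E) `^ r^-1)%E
  | _ => ereal_sup (range (fun k => (S k `^ p^-1)%:E))
  end.

(* Among measurable functions, membership is invariant under a.e. equality on
   [0, 1], so that two such sets of functions are equal iff the corresponding
   subspaces of L^p([0, 1]) are. *)
Definition besov_grid (R : realType) (s p : R) (q : \bar R)
    (P : nat -> set (set R)) : set (R -> R[i]) :=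
  [set f | in_Lp p f /\ exists c : set R -> R[i],
    [/\ (\sum_(0 <= k <oo) Lp_norm p (level s p P c k) < +oo)%E,
        Lp_norm p (fun x => f x - \sum_(k < n) level s p P c k x)
          @[n --> \oo] --> 0%E &
        (coef_norm p q P c < +oo)%E]].

Definition besov (R : realType) (s p : R) (q : \bar R) : set (R -> R[i]) :=
  besov_grid s p q (dyadic_grid R).

(* Main.v *)
(* The grid is the image of the dyadic grid under [x |-> x ^ 2], with intervals
   [((j / 2^k)^2, ((j + 1) / 2^k)^2]]. Near [4^-m] the intervals of its level [k]
   have length about [2^-(k + m)], so they behave like dyadic intervals of level
   [k + m]: the shift between the two levels depends on the location. Put one
   atom, with coefficient [c_m], next to each point [4^-m]. Choosing the level of
   the [m]-th atom so that [k] is constant while [k + m] varies, or the converse,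
   over blocks of consecutive [m], the norm of [c] on a block is an l^p norm for
   one of the grids and an l^q norm for the other one. If [r] is strictly between
   [p] and [q] and [c_m] is about [m^(-1/r)], then, for one of the two choices,
   the norm is finite for the square grid and infinite for the dyadic one.

   That the sum [f] of the atoms is not in the dyadic space is read off its Haar
   coefficients: the atoms of level at most [n] have zero Haar coefficients at
   level [n], and since [s > 0] those of level [n + j] contribute to them with a
   geometric weight [2^(- s j)]. *)

Require Import Defs.
From mathcomp Require Import all_boot all_order all_algebra.
From mathcomp Require Import all_classical all_reals all_analysis.
From mathcomp Require Import complex measurable_realfun.
From mathcomp Require Import ring lra zify.

Import Order.TTheory GRing.Theory Num.Theory.
Import numFieldNormedType.Exports.

Local Open Scope classical_set_scope.
Local Open Scope ring_scope.
Local Open Scope complex_scope.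

Set Implicit Arguments.
Unset Strict Implicit.
Unset Printing Implicit Defensive.

(** * Elementary inequalities for powers and finite sums *)

Section Elementary.
Variable R : realType.
Implicit Types (p t x y z : R).

(** If [x > t], write [x = x ^ p / x ^ (p - 1)] and replace [x] by [t] in the denominator. Summed or
    integrated with a suitable [t], this replaces Hoelder's inequality throughout, at the cost of a
    factor 2. *)
Lemma le_add_powR p t x : 1 <= p -> 0 < t -> 0 <= x ->
  x <= t + x `^ p / t `^ (p - 1).
Proof.
move=> p1 t0 x0; have [xt|tx] := leP x t.
  by rewrite (le_trans xt)// lerDl divr_ge0// powR_ge0.
rewrite (@le_trans _ _ (x `^ p / t `^ (p - 1)))//; last by rewrite lerDr ltW.
rewrite ler_pdivlMr ?powR_gt0// -(@mulr_powRB1 _ x p)//; last first.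
  exact: lt_le_trans p1.
by rewrite ler_wpM2l// ge0_ler_powR ?subr_ge0 ?nnegrE// ltW.
Qed.

Lemma powR_split p x : 0 < x -> x `^ (p - 1) = x `^ p / x.
Proof.
move=> x0; rewrite powRB; last by rewrite (gt_eqF x0) implybT.
by rewrite powRr1// ltW.
Qed.

Lemma exprn_powR x y n : 0 <= x -> (x ^+ n) `^ y = (x `^ y) ^+ n.
Proof.
move=> x0; rewrite -(powR_mulrn n x0) -(powR_mulrn n (powR_ge0 x y)).
by rewrite -!powRrM mulrC.
Qed.

Lemma exprVn_powR y n : (2 ^- n) `^ y = (2 `^ (- y)) ^+ n :> R.
Proof.
by rewrite -exprVn exprn_powR ?invr_ge0// -powR_inv1// -powRrM mulN1r.
Qed.

(* A weak form of Hoelder's inequality: sum the bound of [le_add_powR] for the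
   value of [t] that balances its two terms. *)
Lemma sum_le_powR_sum (I : Type) (r : seq I) (P : pred I) (x : I -> R) p N :
  1 <= p -> (forall i, P i -> 0 <= x i) -> (count P r)%:R <= N ->
  \sum_(i <- r | P i) x i
    <= 2 * N `^ (1 - p^-1) * (\sum_(i <- r | P i) x i `^ p) `^ p^-1.
Proof.
move=> p1 x0 cN; set M := \sum_(i <- r | P i) x i `^ p.
have p0 : 0 < p by exact: lt_le_trans p1.
have key t : 0 < t -> \sum_(i <- r | P i) x i <= t * N + M / t `^ (p - 1).
  move=> t0.
  rewrite (@le_trans _ _ (\sum_(i <- r | P i) (t + x i `^ p / t `^ (p - 1))))//.
    by apply: ler_sum => i Pi; rewrite le_add_powR// x0.
  rewrite big_split/= big_const_seq iter_addr addr0 -mulr_suml lerD2r.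
  by rewrite -mulr_natr ler_wpM2l// ltW.
have M0 : 0 <= M by apply: sumr_ge0 => i _; exact: powR_ge0.
have N0 : 0 <= N by exact: le_trans cN.
have [Mz|Mn] := eqVneq M 0.
  rewrite Mz powR0 ?invr_eq0 ?gt_eqF// mulr0.
  (* The balancing value of [t] would be 0 here, so [t] tends to 0 instead: [t = e / (N + 1)] keeps
     [t * N] below [e]. *)
  apply/ler_addgt0Pl => e e0; rewrite addr0.
  have N1 : 0 < N + 1 by rewrite ltr_wpDl.
  apply: (le_trans (key (e / (N + 1)) _)); first by rewrite divr_gt0.
  rewrite Mz mul0r addr0 -mulrA ler_piMr ?(ltW e0)// mulrC ler_pdivrMr// mul1r.
  by rewrite lerDl.
have Mp : 0 < M by rewrite lt0r Mn.
have Np : 0 < N.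
  rewrite lt0r N0 andbT; apply/eqP => Nz; move: Mn; rewrite /M.
  move: cN; rewrite Nz lern0 => /eqP c0.
  have : ~~ has P r by rewrite has_count c0.
  by move=> hP; rewrite big_hasC ?eqxx.
set t := (M / N) `^ p^-1.
have t0 : 0 < t by rewrite powR_gt0// divr_gt0.
apply: (le_trans (key t t0)).
have tp : t `^ p = M / N.
  by rewrite /t -powRrM mulVf ?gt_eqF// powRr1// divr_ge0.
have tN : t * N = N `^ (1 - p^-1) * M `^ p^-1.
  rewrite /t powRM ?invr_ge0// -[in N^-1]powR_inv1// -(powRrM N) mulN1r.
  rewrite powRD; last by rewrite (gt_eqF Np) implybT.
  by rewrite powRr1// powRN; ring.
have -> : M / t `^ (p - 1) = t * N.
  by rewrite powR_split// tp; field; rewrite !gt_eqF//= ?gt_eqF.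
by rewrite tN -mulrA mulr_natl mulr2n.
Qed.

Lemma sum_geometric_le z n : 0 <= z < 1 -> \sum_(k < n) z ^+ k <= (1 - z)^-1.
Proof.
move=> /andP[z0 z1]; have z10 : 0 < 1 - z by rewrite subr_gt0.
rewrite -[leRHS]mul1r ler_pdivlMr// mulrC.
have -> : (1 - z) * \sum_(k < n) z ^+ k = 1 - z ^+ n.
  by rewrite -(opprB z 1) mulNr -subrX1 opprB.
by rewrite lerBlDr lerDl exprn_ge0.
Qed.

Lemma normr_Re_le_normc (z : R[i]) : `|complex.Re z| <= Normc.normc z.
Proof.
by case: z => a b /=; rewrite -sqrtr_sqr ler_wsqrtr// lerDl sqr_ge0.
Qed.

Lemma normc_real x : Normc.normc x%:C = `|x|.
Proof. by rewrite /= expr0n/= addr0 sqrtr_sqr. Qed.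

End Elementary.

(** * Haar coefficients and dyadic atomic decompositions *)

Section Dyadic.
Variable R : realType.
Local Notation mu := (@lebesgue_measure R).
Local Notation meas := (@measurable _ (measurableTypeR R)).

Definition dyadic (k j : nat) : set R :=
  `[j%:R * 2 ^- k, j.+1%:R * 2 ^- k]%classic.

Lemma measurable_dyadic k j : meas (dyadic k j).
Proof. exact: measurable_itv. Qed.
Hint Resolve measurable_dyadic : core.

Lemma dyadic_scale k d j : j%:R * 2 ^- k = (j * 2 ^ d)%:R * 2 ^- (k + d) :> R.
Proof.
rewrite natrM natrX exprD; field; rewrite !expf_neq0//.
Qed.

Lemma dyadic_inj k : injective (dyadic k).
Proof.
move=> i j ij.
have hk : 0 < 2 ^- k :> R by rewrite invr_gt0 exprn_gt0.
have le a b : dyadic k a = dyadic k b -> (b <= a)%N.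
  move=> ab; have : dyadic k a (a%:R * 2 ^- k).
    by rewrite /dyadic/= in_itv/= lexx/= ler_pM2r// ler_nat.
  by rewrite ab /dyadic/= in_itv/= !ler_pM2r// !ler_nat => /andP[].
by apply/eqP; rewrite eqn_leq !le.
Qed.

Lemma dyadic_sub k d i : dyadic (k + d) i `<=` dyadic k (i %/ 2 ^ d).
Proof.
move=> x; rewrite /dyadic/= !in_itv/= !(dyadic_scale k d).
have hk : 0 < 2 ^- (k + d) :> R by rewrite invr_gt0 exprn_gt0.
move=> /andP[h1 h2]; apply/andP; split.
  by apply: le_trans h1; rewrite ler_pM2r// ler_nat leq_divM.
apply: (le_trans h2); rewrite ler_pM2r// ler_nat.
by rewrite ltn_ceil// expn_gt0.
Qed.

Lemma lebesgue_measure_dyadic k j : mu (dyadic k j) = (2 ^- k)%:E.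
Proof.
have hk : 0 < 2 ^- k :> R by rewrite invr_gt0 exprn_gt0.
rewrite lebesgue_measure_itv/= lte_fin ltr_pM2r// ltr_nat ltnSn -EFinB.
by rewrite -mulrBl -natrB// subSnn mul1r.
Qed.

(** [i %/ 2 ^ d] is the index of the ancestor on level [k]. An interval with another ancestor meets
    [dyadic k j] at most in an endpoint. *)
Lemma lebesgue_measure_dyadicI k d j i :
  mu (dyadic k j `&` dyadic (k + d) i) =
  (if (i %/ 2 ^ d == j)%N then 2 ^- (k + d) else 0)%:E.
Proof.
have hk : 0 < 2 ^- (k + d) :> R by rewrite invr_gt0 exprn_gt0.
have d0 : (0 < 2 ^ d)%N by rewrite expn_gt0.
case: eqVneq => [<-|ij].
  by rewrite (setIidr (@dyadic_sub k d i)) lebesgue_measure_dyadic.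
have [a H] : exists a, dyadic k j `&` dyadic (k + d) i `<=` `[a, a]%classic.
  case: (ltngtP (i %/ 2 ^ d) j) ij => // ij _.
    exists (j%:R * 2 ^- k) => x [] /=; rewrite /dyadic/= !in_itv/=.
    move=> /andP[-> _] /andP[_ h]; apply: (le_trans h).
    rewrite (dyadic_scale k d) ler_pM2r// ler_nat.
    by move: ij; rewrite ltn_divLR.
  exists (j.+1%:R * 2 ^- k) => x [] /=; rewrite /dyadic/= !in_itv/=.
  move=> /andP[_ ->] /andP[h _]; rewrite andbT; apply: le_trans h.
  rewrite (dyadic_scale k d) ler_pM2r// ler_nat.
  by move: ij; rewrite leq_divRL.
apply: (@subset_measure0 _ _ _ mu _ `[a, a]%classic) => //.
  by apply: measurableI; exact: measurable_dyadic.
rewrite set_itv1. exact: lebesgue_measure_set1.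
Qed.

Lemma dyadic_unit k j : (j < 2 ^ k)%N -> dyadic k j `<=` unit_itv R.
Proof.
move=> jk x; rewrite /dyadic /unit_itv/= !in_itv/= => /andP[h1 h2].
have hk : 0 < 2 ^+ k :> R by rewrite exprn_gt0.
apply/andP; split; first by apply: le_trans h1; rewrite divr_ge0// ltW.
apply: (le_trans h2); rewrite ler_pdivrMr// mul1r -natrX ler_nat//.
Qed.

Lemma len_dyadic k j : len (dyadic k j) = 2 ^- k.
Proof. by rewrite /len lebesgue_measure_dyadic. Qed.

Lemma dyadic_gridE k : dyadic_grid R k = dyadic k @` `I_(2 ^ k).
Proof.
apply/seteqP; split => Q /=; first by move=> [j jk ->]; exists j.
by move=> [j jk <-]; exists j.
Qed.

Lemma fsbig_dyadic_grid (V : nmodType) k (F : set R -> V) :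
  \sum_(Q \in dyadic_grid R k) F Q = \sum_(j < 2 ^ k) F (dyadic k j).
Proof.
rewrite dyadic_gridE fsbig_image; last by move=> i j _ _; exact: dyadic_inj.
by rewrite -fsbig_ord.
Qed.

(* Unnormalized: the Haar function of [dyadic n i] takes the values 1 and -1. *)
Definition haar (n i : nat) (g : R -> R) : R :=
  \int[mu]_(x in dyadic n.+1 i.*2) g x - \int[mu]_(x in dyadic n.+1 i.*2.+1) g x.

Lemma Rintegral_indic (D A : set R) : meas D -> meas A ->
  \int[mu]_(x in D) \1_A x = fine (mu (A `&` D)).
Proof. by move=> mD mA; rewrite /Rintegral integral_indic. Qed.

(** For [k <= n] the two halves of [dyadic n i] have the same ancestor on level [k], so they meet
    [dyadic k j] in equal measure and the difference vanishes. For [k > n] the interval [dyadic k j]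
    lies, up to a null set, in one half or outside both. *)
Lemma haar_dyadic_indic n i k j :
  `|haar n i \1_(dyadic k j)| <=
  if (n < k)%N && (j %/ 2 ^ (k - n) == i)%N then 2 ^- k else 0.
Proof.
have hk : 0 <= 2 ^- k :> R by rewrite invr_ge0 exprn_ge0.
rewrite /haar !Rintegral_indic//.
have [nk|kn] /= := ltnP n k.
  have [d kd] : exists d, k = (n.+1 + d)%N by exists (k - n.+1)%N; rewrite subnKC.
  rewrite !(setIC (dyadic k j)) kd !lebesgue_measure_dyadicI/=.
  have -> : (n.+1 + d - n = d.+1)%N by lia.
  rewrite expnS mulnC divnMA.
  set a := (j %/ 2 ^ d)%N.
  have ha : a = ((a %/ 2) * 2 + (a %% 2))%N by exact: divn_eq.
  have h2 : (a %% 2 < 2)%N by rewrite ltn_mod.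
  have [a0|a0] := eqVneq a i.*2; have [a1|a1] := eqVneq a i.*2.+1.
  - by exfalso; lia.
  - by rewrite -kd subr0 ger0_norm// ifT//; apply/eqP; lia.
  - by rewrite -kd sub0r normrN ger0_norm// ifT//; apply/eqP; lia.
  - by rewrite subrr normr0; case: ifP.
have [d nd] : exists d, n.+1 = (k + d.+1)%N by exists (n - k)%N; lia.
rewrite nd !lebesgue_measure_dyadicI/=.
have -> : (i.*2 %/ 2 ^ d.+1 = i.*2.+1 %/ 2 ^ d.+1)%N.
  by rewrite expnS !divnMA -[i.*2.+1]addn1 -muln2 mulnK// divnMDl// addn0.
by rewrite subrr normr0.
Qed.

End Dyadic.
Arguments dyadic : clear implicits.
Arguments measurable_dyadic : clear implicits.
#[local] Hint Resolve measurable_dyadic : core.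

(** * Haar coefficients of the partial sums of a dyadic decomposition *)

Section HaarBound.
Variable R : realType.
Local Notation mu := (@lebesgue_measure R).
Local Notation meas := (@measurable _ (measurableTypeR R)).
Implicit Types (p s : R) (c : set R -> R[i]).

Lemma Rintegral_sum (I : Type) (r : seq I) (P : pred I) (D : set R)
    (f : I -> R -> R) :
  meas D -> (forall i, P i -> mu.-integrable D (EFin \o f i)) ->
  \int[mu]_(x in D) (\sum_(i <- r | P i) f i x) =
  \sum_(i <- r | P i) \int[mu]_(x in D) f i x.
Proof.
move=> mD fi; elim: r => [|i r IH].
  rewrite big_nil; under eq_Rintegral do rewrite big_nil.
  by rewrite Rintegral_cst// mul0r.
rewrite big_cons -IH; case: ifPn => Pi.
  under eq_Rintegral do rewrite big_cons Pi.
  rewrite RintegralD//; first exact: fi.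
  have := @integrable_sum _ _ _ mu D mD I r P _ fi; apply: eq_integrable => // x _ /=.
  by rewrite sumEFin.
by under eq_Rintegral do rewrite big_cons (negbTE Pi).
Qed.

Lemma integrable_indic_finite (D A : set R) : meas D -> meas A ->
  (mu D < +oo)%E -> mu.-integrable D (EFin \o \1_A).
Proof.
move=> mD mA Dfin; apply/integrableP; split.
  by apply/measurable_EFinP; exact: measurable_indic.
under eq_integral do rewrite /= ger0_norm//.
rewrite integral_indic//; apply: le_lt_trans Dfin.
by apply: le_measure; rewrite ?inE//; exact: measurableI.
Qed.

Lemma haar_sum (n i : nat) (I : Type) (r : seq I) (P : pred I)
    (a : I -> R) (A : I -> set R) : (forall i, meas (A i)) ->
  haar n i (fun x => \sum_(l <- r | P l) a l * \1_(A l) x) =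
  \sum_(l <- r | P l) a l * haar n i \1_(A l).
Proof.
move=> mA.
have H j : \int[mu]_(x in dyadic R n.+1 j)
    (\sum_(l <- r | P l) a l * \1_(A l) x) =
    \sum_(l <- r | P l) a l * \int[mu]_(x in dyadic R n.+1 j) \1_(A l) x.
  have fin : (mu (dyadic R n.+1 j) < +oo)%E.
    by rewrite lebesgue_measure_dyadic ltry.
  rewrite Rintegral_sum//.
    apply: eq_bigr => l _; rewrite RintegralZl//.
    exact: integrable_indic_finite.
  move=> l _.
  have := @integrableZl _ _ _ mu _ (measurable_dyadic R n.+1 j) (a l) _
    (integrable_indic_finite (measurable_dyadic R n.+1 j) (mA l) fin).
  by apply: eq_integrable => // x _ /=.
by rewrite /haar !H -sumrB; apply: eq_bigr => l _; rewrite mulrBr.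
Qed.

Lemma ReM_real (z : R[i]) (x : R) : complex.Re (z * x%:C) = complex.Re z * x.
Proof. by case: z => a b /=; rewrite mulr0 subr0. Qed.

Lemma Re_sum (I : Type) (r : seq I) (P : pred I) (F : I -> R[i]) :
  complex.Re (\sum_(i <- r | P i) F i) = \sum_(i <- r | P i) complex.Re (F i).
Proof. by apply: (big_morph (@complex.Re R)) => // -[a b] [a' b']. Qed.

Lemma Re_level p s c k x :
  complex.Re (level s p (dyadic_grid R) c k x) =
  \sum_(j < 2 ^ k) complex.Re (c (dyadic R k j)) * (2 ^- k) `^ (s - p^-1)
    * \1_(dyadic R k j) x.
Proof.
rewrite /level fsbig_dyadic_grid Re_sum; apply: eq_bigr => j _.
by rewrite /atom ReM_real len_dyadic mulrA.
Qed.

(** Each ancestor has [d] descendants. This bounds the number of terms when [sum_le_powR_sum] is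
    applied to a level. *)
Lemma count_divn_mem (d K : nat) (I : seq nat) : (0 < d)%N ->
  (count (fun j => (j %/ d)%N \in I) (index_iota 0 K) <= size I * d)%N.
Proof.
move=> d0; rewrite -size_filter.
have -> : (size I * d = size (flatten [seq iota (i * d) d | i <- I]))%N.
  rewrite size_flatten /shape -map_comp.
  by elim: I => //= i I <-; rewrite size_iota mulSn.
apply: uniq_leq_size; first by rewrite filter_uniq// iota_uniq.
move=> j; rewrite mem_filter => /andP[jI _]; apply/flatten_mapP.
exists (j %/ d)%N => //; rewrite mem_iota {2 3}(divn_eq j d).
by rewrite leq_addr ltn_add2l ltn_mod.
Qed.

Lemma sum_indicator_le (I : seq nat) (j : nat) (b : bool) (e : R) :
  0 <= e -> uniq I ->
  \sum_(i <- I) (if b && (j == i) then e else 0) <=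
  if b && (j \in I) then e else 0.
Proof.
move=> e0 uI; case: b => /=; last by rewrite big1.
case: ifPn => jI.
  rewrite (bigD1_seq j)//= eqxx big1 ?addr0// => i.
  by rewrite eq_sym => /negbTE ->.
by rewrite big_seq big1// => i iI; case: eqP => // ji; rewrite ji iI in jI.
Qed.

Definition coef_sum p (P : nat -> set (set R)) c k : R :=
  \sum_(Q \in P k) Normc.normc (c Q) `^ p.

(** By [haar_dyadic_indic] only the levels [k > n] contribute, each through at most
    [size I * 2 ^ (k - n)] atoms, of weight [2 ^ (- k (1 + s - 1/p))]. The weak Hoelder inequality
    bounds their sum by the l^p norm of the coefficients times [(size I * 2 ^ (k - n)) ^ (1 - 1/p)];
    collecting the powers of 2 leaves the decay [2 ^ (- s (k - n))]. *)
Lemma haar_partial_sum_le p s n (I : seq nat) c N : 1 <= p -> uniq I ->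
  \sum_(i <- I) `|haar n i (fun x =>
      \sum_(k < N) complex.Re (level s p (dyadic_grid R) c k x))| <=
  2 * (size I)%:R `^ (1 - p^-1) * (2 ^- n) `^ (1 + (s - p^-1)) *
  \sum_(k < N | (n < k)%N)
    (2 ^- (k - n)) `^ s * (coef_sum p (dyadic_grid R) c k) `^ p^-1.
Proof.
move=> p1 uI.
pose w k : R := (2 ^- k) `^ (s - p^-1).
pose z k j : R := Normc.normc (c (dyadic R k j)).
have z0 k j : 0 <= z k j.
  by apply: le_trans (normr_Re_le_normc _); exact: normr_ge0.
have e0 k : 0 < 2 ^- k :> R by rewrite invr_gt0 exprn_gt0.
have expand i : haar n i (fun x =>
      \sum_(k < N) complex.Re (level s p (dyadic_grid R) c k x)) =
    \sum_(k < N) \sum_(j < 2 ^ k) complex.Re (c (dyadic R k j)) * w k *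
       haar n i \1_(dyadic R k j).
  (* A single finite sum over pairs of a level and a position, the form that [haar_sum] accepts. *)
  have -> : (fun x => \sum_(k < N)
        complex.Re (level s p (dyadic_grid R) c k x)) =
      (fun x => \sum_(u : {k : 'I_N & 'I_(2 ^ k)})
        complex.Re (c (dyadic R (tag u) (tagged u))) * w (tag u) *
          \1_(dyadic R (tag u) (tagged u)) x).
    apply/funext => x.
    by under eq_bigr do rewrite Re_level; rewrite sig_big_dep.
  by rewrite haar_sum ?sig_big_dep// => u; exact: measurable_dyadic.
rewrite (@le_trans _ _ (\sum_(i <- I) \sum_(k < N) \sum_(j < 2 ^ k)
    z k j * w k * (if (n < k)%N && (j %/ 2 ^ (k - n) == i)%N
                   then 2 ^- k else 0)))//.
  apply: ler_sum => i _; rewrite expand (le_trans (ler_norm_sum _ _ _))//.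
  apply: ler_sum => k _; rewrite (le_trans (ler_norm_sum _ _ _))//.
  apply: ler_sum => j _; rewrite !normrM ler_pM ?mulr_ge0//.
    by rewrite ler_pM ?normr_Re_le_normc// ger0_norm ?powR_ge0.
  exact: haar_dyadic_indic.
rewrite exchange_big/= mulr_sumr [leRHS]big_mkcond/=.
apply: ler_sum => k _; rewrite exchange_big/=.
rewrite (@le_trans _ _ (\sum_(j < 2 ^ k) z k j * w k *
    (if (n < k)%N && ((j %/ 2 ^ (k - n))%N \in I) then 2 ^- k else 0)))//.
  apply: ler_sum => j _; rewrite -mulr_sumr ler_wpM2l//.
    by rewrite mulr_ge0 ?powR_ge0.
  by rewrite sum_indicator_le// ltW.
case: ltnP => nk /=; last by rewrite big1// => j _; rewrite mulr0.
rewrite (eq_bigr (fun j : 'I_(2 ^ k) => if (j %/ 2 ^ (k - n))%N \in I then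
    w k * 2 ^- k * z k j else 0)); last first.
  by move=> j _; case: ifP => _; rewrite ?mulr0//; ring.
rewrite -big_mkcond/= -mulr_sumr.
rewrite -(big_mkord (fun j => (j %/ 2 ^ (k - n))%N \in I) (z k)).
have := @sum_le_powR_sum R nat (index_iota 0 (2 ^ k))
  (fun j => (j %/ 2 ^ (k - n))%N \in I) (z k) p (size I * 2 ^ (k - n))%:R p1
  (fun j _ => z0 k j).
rewrite ler_nat count_divn_mem ?expn_gt0// => /(_ isT) zle.
have w0 : 0 <= w k * 2 ^- k by rewrite mulr_ge0 ?powR_ge0// ltW.
apply: (le_trans (ler_wpM2l w0 zle)).
set S' := \sum_(0 <= j < _ | _) _.
have S'le : S' `^ p^-1 <= (coef_sum p (dyadic_grid R) c k) `^ p^-1.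
  have S'0 : 0 <= S' by apply: sumr_ge0 => j _; exact: powR_ge0.
  have SS : S' <= coef_sum p (dyadic_grid R) c k.
    rewrite /coef_sum fsbig_dyadic_grid /S' big_mkord big_mkcond/=.
    by apply: ler_sum => j _; case: ifP => // _; exact: powR_ge0.
  apply: ge0_ler_powR => //; last by rewrite nnegrE (le_trans S'0).
  by rewrite invr_ge0 (le_trans _ p1).
have nkE : k = (n + (k - n))%N :> nat by rewrite subnKC// ltnW.
have powE (m : nat) (x : R) : (2 ^ m)%:R `^ x = (2 ^- m) `^ (- x) :> R.
  by rewrite -powR_inv1 ?exprn_ge0// -powRrM mulN1r opprK natrX.
have -> : w k * 2 ^- k * (2 * (size I * 2 ^ (k - n))%:R `^ (1 - p^-1) *
      S' `^ p^-1) =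
    2 * (size I)%:R `^ (1 - p^-1) * (2 ^- n) `^ (1 + (s - p^-1)) *
      ((2 ^- (k - n)) `^ s * S' `^ p^-1).
  rewrite natrM powRM// powE /w.
  have -> : 2 ^- k = 2 ^- n * 2 ^- (k - n) :> R.
    by rewrite {1}nkE exprD invfM.
  rewrite powRM ?(ltW (e0 _))//.
  have hD (e x y : R) : 0 < e -> e `^ (x + y) = e `^ x * e `^ y.
    by move=> h; rewrite powRD// (gt_eqF h) implybT.
  have -> : (2 ^- n) `^ (1 + (s - p^-1)) = 2 ^- n * (2 ^- n) `^ (s - p^-1) :> R.
    by rewrite (hD _ 1)// powRr1// ltW.
  have -> : (2 ^- (k - n)) `^ s =
    (2 ^- (k - n)) `^ (s - p^-1) * 2 ^- (k - n)
      * (2 ^- (k - n)) `^ (- (1 - p^-1)) :> R.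
    have := e0 (k - n)%N; set e := 2 ^- (k - n) => e_gt0.
    rewrite -[X in _ * X * _](powRr1 (ltW e_gt0)) -!hD//.
    by congr (_ `^ _); ring.
  ring.
rewrite ler_wpM2l ?mulr_ge0 ?powR_ge0//.
by rewrite ler_wpM2l ?powR_ge0.
Qed.

End HaarBound.

(** * Passage to the limit and bounds for the Haar coefficients of a Besov function *)

Section Limit.
Variable R : realType.
Local Notation mu := (@lebesgue_measure R).
Local Notation meas := (@measurable _ (measurableTypeR R)).
Implicit Types (p s : R) (c : set R -> R[i]).

Lemma Im_sum (I : Type) (r : seq I) (P : pred I) (F : I -> R[i]) :
  complex.Im (\sum_(i <- r | P i) F i) = \sum_(i <- r | P i) complex.Im (F i).
Proof. by apply: (big_morph (@complex.Im R)) => // -[a b] [a' b']. Qed.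

Lemma Im_level p s c k x :
  complex.Im (level s p (dyadic_grid R) c k x) =
  \sum_(j < 2 ^ k) complex.Im (c (dyadic R k j)) * (2 ^- k) `^ (s - p^-1)
    * \1_(dyadic R k j) x.
Proof.
rewrite /level fsbig_dyadic_grid Im_sum.
apply: eq_bigr => j _; rewrite /atom len_dyadic.
by case: (c _) => a b /=; rewrite mulr0 add0r mulrA.
Qed.

Lemma coef_sum_ge0 p P c k : 0 <= coef_sum p P c k.
Proof.
rewrite /coef_sum; apply: fsumr_ge0 => Q _; exact: powR_ge0.
Qed.

Lemma coef_norm_summable p r (P : nat -> set (set R)) c : 1 <= r ->
  (coef_norm p r%:E P c < +oo)%E ->
  exists2 M, 0 <= M &
    forall n, \sum_(k < n) ((coef_sum p P c k) `^ p^-1) `^ r <= M.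
Proof.
move=> r1; rewrite /coef_norm.
have r0 : 0 < r by exact: lt_le_trans r1.
move=> /lty_poweRy; rewrite invr_eq0 gt_eqF// => /(_ isT) fin.
set u : nat -> \bar R := fun k => (coef_sum p P c k `^ (r / p))%:E.
have u0 k : (0 <= u k)%E by rewrite lee_fin powR_ge0.
have S0 : (0 <= \sum_(0 <= k <oo) u k)%E by apply: nneseries_ge0.
exists (fine (\sum_(0 <= k <oo) u k)); first exact: fine_ge0.
move=> n; rewrite -lee_fin fineK ?ge0_fin_numE//.
have -> : (\sum_(k < n) ((coef_sum p P c k) `^ p^-1) `^ r)%:E =
    (\sum_(0 <= k < n) u k)%E.
  rewrite -sumEFin big_mkord; apply: eq_bigr => k _.
  by rewrite /u -powRrM mulrC.
exact: nneseries_lim_ge.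
Qed.

Lemma coef_norm_bounded p q (P : nat -> set (set R)) c : (1 <= q)%E ->
  (coef_norm p q P c < +oo)%E ->
  exists2 M, 0 <= M & forall k, (coef_sum p P c k) `^ p^-1 <= M.
Proof.
case: q => [r||//]; last first.
  move=> _; rewrite /coef_norm.
  set A : set \bar R := range (fun k => (coef_sum p P c k `^ p^-1)%:E) => fin.
  have le k : ((coef_sum p P c k `^ p^-1)%:E <= ereal_sup A)%E.
    by apply: ereal_sup_ubound; exists k.
  have A0 : (0 <= ereal_sup A)%E.
    by apply: le_trans (le 0%N); rewrite lee_fin powR_ge0.
  exists (fine (ereal_sup A)); first exact: fine_ge0.
  by move=> k; rewrite -lee_fin fineK ?ge0_fin_numE.
rewrite lee_fin => r1 /(coef_norm_summable r1)[M M0 MP].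
have r0 : 0 < r by exact: lt_le_trans r1.
exists (M `^ r^-1); first exact: powR_ge0.
move=> k; set T := coef_sum p P c k `^ p^-1.
have TM : T `^ r <= M.
  apply: le_trans (MP k.+1); rewrite big_ord_recr/= lerDr.
  by apply: sumr_ge0 => i _; exact: powR_ge0.
have -> : T = (T `^ r) `^ r^-1.
  by rewrite -powRrM mulfV ?gt_eqF// powRr1// powR_ge0.
apply: ge0_ler_powR => //; rewrite ?nnegrE ?powR_ge0//.
by rewrite invr_ge0 ltW.
Qed.

Lemma Lp_normX p f : 0 < p ->
  (Lp_norm p f `^ p = \int[mu]_(x in unit_itv R) (Normc.normc (f x) `^ p)%:E)%E.
Proof.
move=> p0; rewrite /Lp_norm poweR_Lnorm ?gt_eqF// [RHS]integral_mkcond.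
apply: eq_integral => x _ /=; rewrite !patchE; case: ifP => _ /=.
  rewrite -poweR_EFin ger0_norm//.
  by apply: le_trans (normr_Re_le_normc _); exact: normr_ge0.
by rewrite normr0 powR0// gt_eqF.
Qed.

Lemma measurable_unit_itv : meas (unit_itv R).
Proof. exact: measurable_itv. Qed.

Lemma lebesgue_measure_unit_itv : mu (unit_itv R) = 1%E.
Proof. by rewrite lebesgue_measure_itv/= lte_fin ltr01 -EFinB subr0. Qed.

(** The L^1 norm against the L^p norm on a space of measure 1: integrate [le_add_powR], with [t] the
    given bound on the L^p norm. *)
Lemma integral_Re_le p (f : R -> R[i]) t : 1 <= p ->
  measurable_fun (unit_itv R) (fun x => complex.Re (f x)) ->
  measurable_fun (unit_itv R) (fun x => complex.Im (f x)) ->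
  0 < t -> (Lp_norm p f <= t%:E)%E ->
  (\int[mu]_(x in unit_itv R) `|complex.Re (f x)|%:E <= (2 * t)%:E)%E.
Proof.
move=> p1 mRe mIm t0 Nt; have p0 : 0 < p by exact: lt_le_trans p1.
have mn : measurable_fun (unit_itv R) (fun x => Normc.normc (f x)).
  have -> : (fun x => Normc.normc (f x)) = Num.sqrt \o
      (fun x => complex.Re (f x) ^+ 2 + complex.Im (f x) ^+ 2).
    by apply/funext => x /=; case: (f x).
  apply: measurableT_comp.
    apply: continuous_measurable_fun; exact: sqrt_continuous.
  by apply: measurable_funD; apply: measurable_funX.
have mnp : measurable_fun (unit_itv R) (fun x => Normc.normc (f x) `^ p).
  by apply: (measurableT_comp (measurable_powR _)).
have n0 x : 0 <= Normc.normc (f x).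
  by apply: le_trans (normr_Re_le_normc _); exact: normr_ge0.
have tp0 : 0 < t `^ (p - 1) by exact: powR_gt0.
have mU := measurable_unit_itv.
apply: (@le_trans _ _ (\int[mu]_(x in unit_itv R)
  (t%:E + (t `^ (p - 1))^-1%:E * (Normc.normc (f x) `^ p)%:E))%E).
  apply: ge0_le_integral => //.
  - apply/measurable_EFinP; exact: measurableT_comp.
  - apply: emeasurable_funD => //; apply: measurable_funeM.
    exact/measurable_EFinP.
  - move=> x _; rewrite -EFinM -EFinD lee_fin.
    by apply: (le_trans (normr_Re_le_normc _)); rewrite mulrC le_add_powR.
rewrite ge0_integralD//; last 3 first.
- by move=> x _; rewrite lee_fin ltW.
- by move=> x _; rewrite -EFinM lee_fin mulr_ge0 ?powR_ge0// invr_ge0 ltW.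
- by apply: measurable_funeM; exact/measurable_EFinP.
rewrite integral_cst// [X in (_ * X)%E](lebesgue_measure_unit_itv) mule1.
rewrite ge0_integralZl//; last 3 first.
- exact/measurable_EFinP.
- by move=> x _; rewrite lee_fin powR_ge0.
- by rewrite lee_fin invr_ge0 ltW.
rewrite -Lp_normX// mulr_natl mulr2n EFinD leeD2l//.
have -> : t%:E = ((t `^ (p - 1))^-1%:E * (t%:E `^ p))%E.
  rewrite poweR_EFin -EFinM powR_split//; congr EFin.
  by field; rewrite !gt_eqF// powR_gt0.
apply: lee_wpmul2l; first by rewrite lee_fin invr_ge0 ltW.
apply: gt0_ler_poweR => //; rewrite ?ltW// in_itv/= ?leey ?andbT//.
  exact: Lnorm_ge0.
by rewrite lee_fin ltW.
Qed.

Lemma Re_integrable p (f : R -> R[i]) : 1 <= p -> in_Lp p f ->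
  mu.-integrable (unit_itv R) (fun x => (complex.Re (f x))%:E).
Proof.
move=> p1 [mRe mIm fin]; apply/integrableP; split; first exact/measurable_EFinP.
have N0 : (0 <= Lp_norm p f)%E by exact: Lnorm_ge0.
apply: (@le_lt_trans _ _ (2 * (fine (Lp_norm p f) + 1))%:E); last exact: ltry.
apply: (@integral_Re_le p) => //; first by rewrite ltr_wpDl ?fine_ge0.
by rewrite EFinD fineK ?ge0_fin_numE// leeDl.
Qed.

Lemma haar_Re_le p (f : R -> R[i]) n i t : 1 <= p -> in_Lp p f ->
  (i < 2 ^ n)%N -> 0 < t -> (Lp_norm p f <= t%:E)%E ->
  `|haar n i (fun x => complex.Re (f x))| <= 4 * t.
Proof.
move=> p1 fLp i2 t0 ft; have [mRe mIm _] := fLp.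
have mU := measurable_unit_itv.
have H j : (j < 2 ^ n.+1)%N ->
    `|\int[mu]_(x in dyadic R n.+1 j) complex.Re (f x)| <= 2 * t.
  move=> jn; have sub := dyadic_unit (R := R) jn.
  have mD := measurable_dyadic R n.+1 j.
  have fiU := Re_integrable p1 fLp.
  have fi := integrableS mU mD sub fiU.
  have /integrableP[mf _] := fiU.
  rewrite -lee_fin EFin_normr_Rintegral//.
  apply: (le_trans (le_abse_integral _ _ _)) => //.
    exact: measurable_funS sub mf.
  apply: (@le_trans _ _ (\int[mu]_(x in unit_itv R) `|complex.Re (f x)|%:E)%E).
    apply: ge0_subset_integral => //.
    by apply/measurable_EFinP; exact: measurableT_comp.
  exact: (@integral_Re_le p).
rewrite (le_trans (ler_normB _ _))//.
have -> : 4 * t = 2 * t + 2 * t by ring.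
by apply: lerD; apply: H; rewrite expnS; lia.
Qed.

Lemma haar_ReB p (f g : R -> R[i]) n i : 1 <= p -> in_Lp p f -> in_Lp p g ->
  (i < 2 ^ n)%N ->
  haar n i (fun x => complex.Re (f x - g x)) =
  haar n i (fun x => complex.Re (f x)) - haar n i (fun x => complex.Re (g x)).
Proof.
move=> p1 fLp gLp i2.
have mU := measurable_unit_itv.
have H j : (j < 2 ^ n.+1)%N ->
    \int[mu]_(x in dyadic R n.+1 j) complex.Re (f x - g x) =
    \int[mu]_(x in dyadic R n.+1 j) complex.Re (f x) -
    \int[mu]_(x in dyadic R n.+1 j) complex.Re (g x).
  move=> jn; have sub := dyadic_unit (R := R) jn.
  have mD := measurable_dyadic R n.+1 j.
  have fi := integrableS mU mD sub (Re_integrable p1 fLp).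
  have gi := integrableS mU mD sub (Re_integrable p1 gLp).
  rewrite -RintegralB//; apply: eq_Rintegral => x _.
  by case: (f x) => a b; case: (g x).
by rewrite /haar !H; [ring|rewrite expnS; lia..].
Qed.

(** The finiteness is assumed because the convergence of the partial sums provides it for large [N];
    what remains is measurability. *)
Lemma in_Lp_subr_partial_sum p s c f N : in_Lp p f ->
  (Lp_norm p (fun x => f x - \sum_(k < N) level s p (dyadic_grid R) c k x)%R
    < +oo)%E ->
  in_Lp p (fun x => f x - \sum_(k < N) level s p (dyadic_grid R) c k x).
Proof.
move=> [mRe mIm _] fin; split=> //.
- have -> : (fun x => complex.Re
      (f x - \sum_(k < N) level s p (dyadic_grid R) c k x)) =
      (fun x => complex.Re (f x) - \sum_(k < N) \sum_(j < 2 ^ k)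
        complex.Re (c (dyadic R k j)) * (2 ^- k) `^ (s - p^-1)
          * \1_(dyadic R k j) x).
    apply/funext => x; under [in RHS]eq_bigr do rewrite -Re_level.
    by rewrite -Re_sum; case: (f x) => a b; case: (\sum_(k < N) _).
  apply: measurable_funB => //; apply: measurable_sum => k.
  apply: measurable_sum => j; apply: measurable_funM => //.
  apply: measurable_indic; exact: measurable_dyadic.
- have -> : (fun x => complex.Im
      (f x - \sum_(k < N) level s p (dyadic_grid R) c k x)) =
      (fun x => complex.Im (f x) - \sum_(k < N) \sum_(j < 2 ^ k)
        complex.Im (c (dyadic R k j)) * (2 ^- k) `^ (s - p^-1)
          * \1_(dyadic R k j) x).
    apply/funext => x; under [in RHS]eq_bigr do rewrite -Im_level.
    by rewrite -Im_sum; case: (f x) => a b; case: (\sum_(k < N) _).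
  apply: measurable_funB => //; apply: measurable_sum => k.
  apply: measurable_sum => j; apply: measurable_funM => //.
  apply: measurable_indic; exact: measurable_dyadic.
Qed.

(** Finitely many Haar coefficients depend continuously on the function in L^p, so a bound uniform
    in [N] survives in the limit. Level and position both depend on [l], which serves for many
    positions on one level as well as for one position on each of many levels. *)
Lemma haar_sum_le_of_partial p s c f (I : Type) (r : seq I)
    (w : I -> R) (n i : I -> nat) B : 1 <= p -> in_Lp p f ->
  Lp_norm p (fun x => f x - \sum_(k < N) level s p (dyadic_grid R) c k x)
    @[N --> \oo] --> 0%E ->
  (forall l, 0 <= w l) -> (forall l, (i l < 2 ^ n l)%N) ->
  (forall N, \sum_(l <- r) w l * `|haar (n l) (i l) (fun x =>
     \sum_(k < N) complex.Re (level s p (dyadic_grid R) c k x))| <= B) ->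
  \sum_(l <- r) w l * `|haar (n l) (i l) (fun x => complex.Re (f x))| <= B.
Proof.
move=> p1 fLp cvg0 w0 i2 HB; apply/ler_addgt0Pr => e e0.
pose W := \sum_(l <- r) w l.
have W0 : 0 <= W by apply: sumr_ge0.
(* An L^p error below [t] moves each coefficient by at most [4 * t], hence the weighted sum by at
   most [e]; the 1 avoids a division by zero. *)
pose t := e / (4 * (W + 1)).
have W1 : 0 < W + 1 by rewrite ltr_wpDl.
have t0 : 0 < t by rewrite divr_gt0// mulr_gt0.
have [N HN] : exists N, (Lp_norm p (fun x =>
    f x - \sum_(k < N) level s p (dyadic_grid R) c k x)%R < t%:E)%E.
  have /cvg0 : nbhs (0%E : \bar R) [set y | (y < t%:E)%E].
    by apply: open_nbhs_nbhs; split; [exact: open_ereal_lt_ereal|rewrite /= lte_fin].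
  by case=> N _ /(_ N (leqnn _)) /= h; exists N.
have hLp := in_Lp_subr_partial_sum fLp (lt_trans HN (ltry t)).
set h := (X in in_Lp p X) in hLp.
apply: (@le_trans _ _ (\sum_(l <- r) (w l * `|haar (n l) (i l) (fun x =>
     \sum_(k < N) complex.Re (level s p (dyadic_grid R) c k x))|
     + w l * (4 * t)))).
  apply: ler_sum => l _; rewrite -mulrDr ler_wpM2l//.
  have -> : (fun x => \sum_(k < N)
        complex.Re (level s p (dyadic_grid R) c k x)) =
      (fun x => complex.Re (f x - h x)).
    by apply/funext => x; rewrite /h subKr Re_sum.
  rewrite (haar_ReB p1 fLp hLp (i2 l)).
  have := haar_Re_le p1 hLp (i2 l) t0 (ltW HN).
  set b := haar _ _ _; set a := haar _ _ _ => bt.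
  by rewrite -{1}(subrK b a) (le_trans (ler_normD _ _))// lerD2l.
rewrite big_split/=; apply: lerD; first exact: HB.
rewrite -mulr_suml -/W /t.
have -> : W * (4 * (e / (4 * (W + 1)))) = e * (W / (W + 1)).
  by field; rewrite gt_eqF.
by rewrite ler_piMr ?(ltW e0)// ler_pdivrMr// mul1r lerDl.
Qed.

(** The substitution [k = n + j], after enlarging the range to [n + N]; the term [j = 0] is added
    too, so that the range of [j] no longer depends on [n]. *)
Lemma sum_decay_le s (T : nat -> R) n N : (forall k, 0 <= T k) ->
  \sum_(k < N | (n < k)%N) (2 ^- (k - n)) `^ s * T k <=
  \sum_(j < N) (2 `^ (- s)) ^+ j * T (n + j)%N.
Proof.
move=> T0.
have pos k : 0 <= (2 ^- (k - n)) `^ s * T k by rewrite mulr_ge0 ?powR_ge0.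
rewrite (@le_trans _ _
  (\sum_(k < n + N | (n < k)%N) (2 ^- (k - n)) `^ s * T k))//.
  rewrite -(big_mkord (fun k => n < k)%N (fun k => (2 ^- (k - n)) `^ s * T k)).
  rewrite -(big_mkord (fun k => n < k)%N (fun k => (2 ^- (k - n)) `^ s * T k)).
  rewrite (big_cat_nat (n := N) _ (leq_addl n N))//= lerDl.
  by apply: sumr_ge0.
rewrite big_split_ord/= big1 ?add0r; last first.
  by move=> k; rewrite ltnNge ltnW.
rewrite big_mkcond/=; apply: ler_sum => j _; rewrite addKn exprVn_powR.
by case: ifP => // _; rewrite mulr_ge0// exprn_ge0// powR_ge0.
Qed.

Lemma powR2N_itv s : 0 < s -> 0 <= (2 : R) `^ (- s) < 1.
Proof.
move=> s0; rewrite powR_ge0 powRN invf_lt1 ?powR_gt0//=.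
by rewrite -[ltLHS](congr1 (fun f => f s) (powR1 R)) gt0_ltr_powR// ?nnegrE// ltr1n.
Qed.

(** The estimate that detects the l^p norm inside a level. Of the Besov norm it retains that the l^p
    norms of the levels are bounded; the decay in [k - n] is then summed as a geometric series. *)
Lemma besov_haar_sum_le p s q f : 1 <= p -> (1 <= q)%E -> 0 < s ->
  besov s p q f -> exists2 C, 0 <= C &
    forall n (I : seq nat), uniq I -> {in I, forall i, (i < 2 ^ n)%N} ->
    \sum_(i <- I) `|haar n i (fun x => complex.Re (f x))|
      <= C * (size I)%:R `^ (1 - p^-1) * (2 ^- n) `^ (1 + (s - p^-1)).
Proof.
move=> p1 q1 s0 [fLp [c [_ cvg0 cfin]]].
have [M M0 MT] := coef_norm_bounded q1 cfin.
have z01 := powR2N_itv s0; set z := 2 `^ (- s) in z01.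
exists (2 * (M * (1 - z)^-1)).
  by rewrite !mulr_ge0// invr_ge0 subr_ge0; case/andP: z01 => _ /ltW.
move=> n I uI I2.
(* Weights 0 or 1 and the default position 0 turn the condition on the members of [I] into one that
   holds for every index. *)
have := @haar_sum_le_of_partial p s c f nat I (fun i => (i < 2 ^ n)%N%:R)
  (fun=> n) (fun i => if (i < 2 ^ n)%N then i else 0%N).
have E (g : R -> R) : \sum_(i <- I) (i < 2 ^ n)%N%:R *
    `|haar n (if (i < 2 ^ n)%N then i else 0%N) g| = \sum_(i <- I) `|haar n i g|.
  by rewrite [LHS]big_seq [RHS]big_seq; apply: eq_bigr => i /I2 ->; rewrite mul1r.
rewrite E; apply => //.
  by move=> i; case: ifP => //; rewrite expn_gt0.
move=> N; rewrite E; apply: (le_trans (haar_partial_sum_le s n c N p1 uI)).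
have swap (a b x : R) : 2 * x * a * b = 2 * a * b * x by ring.
rewrite [leRHS]swap ler_wpM2l ?mulr_ge0 ?powR_ge0//.
apply: (le_trans (sum_decay_le s n N (fun k => powR_ge0 (coef_sum p _ c k) _))).
rewrite (@le_trans _ _ (\sum_(j < N) z ^+ j * M))//.
  by apply: ler_sum => j _; rewrite ler_wpM2l// exprn_ge0//; case/andP: z01.
by rewrite -mulr_suml mulrC ler_wpM2l// sum_geometric_le.
Qed.

(** The estimate that detects the l^r norm across levels. With one coefficient per level, the bound
    is a convolution of the level norms with the weights [2 ^ (- s j)]; for each [j], Hoelder over
    the [L] levels gives the factor [L ^ (1 - 1/r)], uniformly in [n0]. *)
Lemma besov_haar_diagonal_le p s r f : 1 <= p -> 1 <= r -> 0 < s ->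
  besov s p r%:E f -> exists2 C, 0 <= C &
    forall (n0 L : nat) (i : nat -> nat), (forall n, (i n < 2 ^ n)%N) ->
    \sum_(n0 <= n < n0 + L) (2 ^- n) `^ (- (1 + (s - p^-1))) *
        `|haar n (i n) (fun x => complex.Re (f x))| <= C * L%:R `^ (1 - r^-1).
Proof.
move=> p1 r1 s0 [fLp [c [_ cvg0 cfin]]].
have [M M0 MT] := coef_norm_summable r1 cfin.
have z01 := powR2N_itv s0; set z := 2 `^ (- s) in z01.
have z0 : 0 <= z by case/andP: z01.
pose T k := (coef_sum p (dyadic_grid R) c k) `^ p^-1.
have T0 k : 0 <= T k by exact: powR_ge0.
exists (4 * (M `^ r^-1 * (1 - z)^-1)).
  rewrite !mulr_ge0 ?powR_ge0// invr_ge0 subr_ge0.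
  by case/andP: z01 => _ /ltW.
move=> n0 L i i2; set d := 1 + (s - p^-1).
apply: (@haar_sum_le_of_partial p s c f nat _ (fun n => (2 ^- n) `^ (- d))
  id i _ p1 fLp cvg0) => // N.
rewrite (@le_trans _ _
    (\sum_(n0 <= n < n0 + L) 2 * \sum_(j < N) z ^+ j * T (n + j)%N))//.
  apply: ler_sum => n _.
  have := @haar_partial_sum_le R p s n [:: i n] c N p1 isT.
  rewrite big_seq1/= powR1 mulr1 => H.
  apply: (le_trans (ler_wpM2l (powR_ge0 _ _) H)).
  have -> (a b x : R) : a * (2 * b * x) = 2 * (a * b * x) by ring.
  rewrite ler_wpM2l// -powRD; last first.
    by rewrite invr_eq0 expf_eq0 (eqr_nat R 2 0) andbF implybT.
  by rewrite addNr powRr0 mul1r; exact: sum_decay_le.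
rewrite -mulr_sumr exchange_big/=.
have -> : 4 * (M `^ r^-1 * (1 - z)^-1) * L%:R `^ (1 - r^-1) =
  2 * ((1 - z)^-1 * (2 * L%:R `^ (1 - r^-1) * M `^ r^-1)) by ring.
rewrite ler_wpM2l//.
rewrite (@le_trans _ _
    (\sum_(j < N) z ^+ j * (2 * L%:R `^ (1 - r^-1) * M `^ r^-1)))//; last first.
  rewrite -mulr_suml ler_wpM2r ?mulr_ge0 ?powR_ge0//.
  exact: sum_geometric_le.
apply: ler_sum => j _; rewrite -mulr_sumr ler_wpM2l ?exprn_ge0//.
have := @sum_le_powR_sum R nat (index_iota n0 (n0 + L)) xpredT
  (fun n => T (n + j)%N) r L%:R r1 (fun n _ => T0 _).
rewrite count_predT size_iota addKn lexx => /(_ isT) H.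
apply: (le_trans H); rewrite ler_wpM2l ?mulr_ge0 ?powR_ge0//.
have le : \sum_(n0 <= n < n0 + L) T (n + j)%N `^ r <= M.
  apply: le_trans (MT (n0 + L + j)%N).
  rewrite -(big_mkord xpredT (fun k => T k `^ r)).
  have le1 : (n0 + j <= n0 + L + j)%N by lia.
  rewrite (big_cat_nat (leq0n _) le1)/= big_addn addnK.
  by rewrite lerDr; apply: sumr_ge0 => k _; exact: powR_ge0.
apply: ge0_ler_powR => //.
- by rewrite invr_ge0 (le_trans _ r1).
- by rewrite nnegrE; apply: sumr_ge0 => k _; exact: powR_ge0.
Qed.

End Limit.
Arguments measurable_unit_itv : clear implicits.

(** * The image of the dyadic grid under squaring *)

Section SquareGrid.
Variable R : realType.
Local Notation mu := (@lebesgue_measure R).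
Local Notation meas := (@measurable _ (measurableTypeR R)).

Definition sqpt (k j : nat) : R := (j%:R / 2 ^+ k) ^+ 2.

(* Half-open intervals make distinct members of a level disjoint. *)
Definition sqitv (k j : nat) : set R := `]sqpt k j, sqpt k j.+1]%classic.

Definition square_grid (k : nat) : set (set R) := sqitv k @` `I_(2 ^ k).

Let e0 k : 0 < 2 ^+ k :> R. Proof. by rewrite exprn_gt0. Qed.

Lemma sqptE k j : sqpt k j = (j ^ 2)%:R / 4 ^+ k.
Proof.
rewrite /sqpt expr_div_n natrX -exprM mulnC exprM.
by have -> : 2 ^+ 2 = 4 :> R by ring.
Qed.

Lemma ltr_sqpt k i j : (sqpt k i < sqpt k j) = (i < j)%N.
Proof. by rewrite !sqptE ltr_pM2r ?invr_gt0 ?exprn_gt0// ltr_nat ltn_sqr. Qed.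

Lemma ler_sqpt k i j : (sqpt k i <= sqpt k j) = (i <= j)%N.
Proof. by rewrite leNgt ltr_sqpt -leqNgt. Qed.

Lemma sqptS k j : sqpt k j = sqpt k.+1 j.*2.
Proof.
rewrite /sqpt -muln2 natrM (exprS 2 k); congr (_ ^+ 2); field.
by rewrite gt_eqF.
Qed.

Lemma measurable_sqitv k j : meas (sqitv k j).
Proof. exact: measurable_itv. Qed.

Lemma lebesgue_measure_sqitv k j : mu (sqitv k j) = (j.*2.+1%:R / 4 ^+ k)%:E.
Proof.
rewrite lebesgue_measure_itv/= lte_fin ltr_sqpt ltnSn -EFinB !sqptE -mulrBl.
congr (_ / _)%:E; rewrite -natrB ?leq_sqr//; congr _%:R.
by rewrite -addn1 sqrnD -addnn; lia.
Qed.

Lemma len_sqitv k j : len (sqitv k j) = j.*2.+1%:R / 4 ^+ k.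
Proof. by rewrite /len lebesgue_measure_sqitv. Qed.

Lemma len_sqitv_gt0 k j : 0 < len (sqitv k j).
Proof. by rewrite len_sqitv divr_gt0 ?exprn_gt0. Qed.

Lemma sqitv_right k j : sqitv k j (sqpt k j.+1).
Proof. by rewrite /sqitv/= in_itv/= lexx ltr_sqpt ltnSn. Qed.

Lemma sqitv_cap_eq k i j x : sqitv k i x -> sqitv k j x -> i = j.
Proof.
rewrite /sqitv/= !in_itv/= => /andP[a b] /andP[c d].
have := lt_le_trans a d; have := lt_le_trans c b.
by rewrite !ltr_sqpt !ltnS => ? ?; apply/eqP; rewrite eqn_leq; apply/andP.
Qed.

(** The 2-adic valuations of the two sides are [2 * l] and [2 * k]. *)
Lemma odd_mul_pow4_inj i k j l :
  (i.*2.+1 * 4 ^ l = j.*2.+1 * 4 ^ k)%N -> l = k.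
Proof.
move=> H; have : logn 2 (i.*2.+1 * 4 ^ l) = logn 2 (j.*2.+1 * 4 ^ k) by rewrite H.
have odd2 a : logn 2 a.*2.+1 = 0%N by rewrite logn_coprime// coprime2n/= odd_double.
rewrite !lognM ?expn_gt0// !odd2 (_ : 4%N = 2 ^ 2)%N// -!expnM !pfactorK//; lia.
Qed.

(* A member of the grid belongs to a single level because the numerator of its
   length over [4 ^ k] is odd. *)
Lemma sqitv_inj k i l j : sqitv k i = sqitv l j -> k = l /\ i = j.
Proof.
move=> H; have kl : k = l.
  have := congr1 (@len R) H; rewrite !len_sqitv => /eqP.
  rewrite eqr_div ?expf_neq0 ?pnatr_eq0// -!natrX -!natrM eqr_nat => /eqP.
  by move=> /odd_mul_pow4_inj.
split => //; rewrite kl in H.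
by apply: (@sqitv_cap_eq l i j (sqpt l i.+1)); rewrite -?H; exact: sqitv_right.
Qed.

Lemma fsbig_square_grid (V : nmodType) k (F : set R -> V) :
  \sum_(Q \in square_grid k) F Q = \sum_(j < 2 ^ k) F (sqitv k j).
Proof.
rewrite fsbig_image; last by move=> i j _ _ /sqitv_inj[].
by rewrite -fsbig_ord.
Qed.

Lemma sqpt_itv k j : (j <= 2 ^ k)%N -> 0 <= sqpt k j <= 1.
Proof.
move=> jk; rewrite /sqpt sqr_ge0/= expr_le1// ?divr_ge0//.
by rewrite ler_pdivrMr// mul1r -natrX ler_nat.
Qed.

Lemma sqitv_unit k j : (j < 2 ^ k)%N -> sqitv k j `<=` unit_itv R.
Proof.
move=> jk x; rewrite /sqitv /unit_itv/= !in_itv/= => /andP[/ltW a b].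
have /andP[h0 _] := sqpt_itv (ltnW jk); have /andP[_ h1] := sqpt_itv jk.
by rewrite (le_trans h0)//= (le_trans b).
Qed.

Lemma sqitv_cover k x : 0 < x -> x <= 1 ->
  exists2 j, (j < 2 ^ k)%N & sqitv k j x.
Proof.
move=> x0 x1.
have ex : exists j, x <= sqpt k j.
  by exists (2 ^ k)%N; rewrite /sqpt natrX divff ?gt_eqF// expr1n.
have [j xj jmin] := ex_minnP ex.
case: j xj jmin => [|j] xj jmin.
  by move: xj; rewrite /sqpt mul0r expr0n/= leNgt x0.
exists j.
  rewrite ltnNge; apply/negP => jk; have := jmin (2 ^ k)%N.
  rewrite /sqpt natrX divff ?gt_eqF// expr1n => /(_ x1); lia.
rewrite /sqitv/= in_itv/= xj andbT ltNge; apply/negP => /jmin; lia.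
Qed.

Lemma sqitv_half k j : sqitv k.+1 j `<=` sqitv k j./2.
Proof.
move=> x; rewrite /sqitv/= !in_itv/= => /andP[a b].
rewrite !(sqptS k); apply/andP; split.
  by apply: le_lt_trans a; rewrite ler_sqpt; lia.
by apply: le_trans b _; rewrite ler_sqpt; lia.
Qed.

Lemma len_sqitv_le k j : (j < 2 ^ k)%N -> len (sqitv k j) <= 2 / 2 ^+ k.
Proof.
move=> jk; rewrite len_sqitv ler_pdivrMr ?exprn_gt0//.
have -> : 4 = 2 * 2 :> R by ring.
rewrite exprMn.
have -> : 2 / 2 ^+ k * (2 ^+ k * 2 ^+ k) = 2 * 2 ^+ k :> R.
  by field; rewrite gt_eqF.
by rewrite -natrX -natrM ler_nat; lia.
Qed.

Lemma len_sqitvE k j : len (sqitv k j) = sqpt k j.+1 - sqpt k j.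
Proof.
rewrite len_sqitv !sqptE -mulrBl -natrB ?leq_sqr//; congr (_%:R / _).
by rewrite -[j.+1]addn1 sqrnD -addnn; lia.
Qed.

Local Notation gen :=
  (<<s unit_itv R, \bigcup_k square_grid k >> : set (set R)).

Lemma gen_bigcup (A : (set R)^nat) :
  (forall n, gen (A n)) -> gen (\bigcup_n A n).
Proof. exact: sigma_algebra_bigcup. Qed.

(** For [x >= 0] this is the countable union of the grid intervals whose left endpoint is at least
    [x]: on a fine enough level, the interval around a given [y > x] is shorter than [y - x]. *)
Lemma gen_unit_setI_ray x : gen (unit_itv R `&` `]x, +oo[%classic).
Proof.
have genT : gen (unit_itv R).
  rewrite -[X in gen X]setD0; apply: sigma_algebraCD; exact: sigma_algebra0.
(* For [x < 0] the set contains 0, which no half-open interval of the grid covers, but it is then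
   the whole unit interval. *)
have [x0|x0] := ltP x 0.
  rewrite (_ : _ `&` _ = unit_itv R)//; apply: setIidl => y.
  rewrite /unit_itv/= !in_itv/= andbT => /andP[y0 _]; exact: lt_le_trans y0.
pose A k j := if `[< (j < 2 ^ k)%N /\ x <= sqpt k j >] then sqitv k j else set0.
have -> : unit_itv R `&` `]x, +oo[%classic = \bigcup_k \bigcup_j A k j.
  apply/seteqP; split => [y|y [k _ [j _]]]; last first.
    rewrite /A; case: asboolP => // -[jk xj] yQ; split; first exact: sqitv_unit yQ.
    rewrite /= in_itv/= andbT; move: yQ; rewrite /sqitv/= in_itv/= => /andP[+ _].
    exact: le_lt_trans.
  rewrite /unit_itv/= !in_itv/= andbT => -[/andP[y0 y1] xy].
  have yx : 0 < y - x by rewrite subr_gt0.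
  have [k Hk] : exists k, 2 / 2 ^+ k < y - x.
    exists (Num.trunc (2 / (y - x))).+1; set k := (Num.trunc _).+1.
    have h1 : 2 / (y - x) < k%:R by exact: truncnS_gt.
    have h2 : k%:R < 2 ^+ k :> R by rewrite -natrX ltr_nat ltn_expl.
    by rewrite ltr_pdivrMr// mulrC -ltr_pdivrMr// (lt_trans h1).
  have [j jk yj] := sqitv_cover k (le_lt_trans x0 xy) y1.
  exists k => //; exists j => //; rewrite /A; case: asboolP => // H; exfalso.
  apply: H; split => //.
  have := len_sqitv_le jk; rewrite len_sqitvE.
  move: yj; rewrite /sqitv/= in_itv/= => /andP[a b]; lra.
apply: gen_bigcup => k; apply: gen_bigcup => j; rewrite /A.
case: asboolP => [[jk _]|_]; last exact: sigma_algebra0.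
by apply: sub_sigma_algebra; exists k => //; exists j.
Qed.

(** The sets with a generated trace on the unit interval form a sigma-algebra containing the open
    rays, and these generate the Borel sets. *)
Lemma gen_borel (B : set R) : meas B -> gen (unit_itv R `&` B).
Proof.
rewrite [meas](RGenOInfty.measurableE R).
pose G := [set B : set R | gen (unit_itv R `&` B)].
suff : <<s @RGenOInfty.G R >> `<=` G by apply.
apply: smallest_sub; last first.
  by move=> _ [x ->]; exact: gen_unit_setI_ray.
split; rewrite /G/=.
- by rewrite setI0; exact: sigma_algebra0.
- move=> A gA; rewrite setTD -setDE.
  rewrite (_ : _ `\` _ = unit_itv R `\` (unit_itv R `&` A)).
    exact: sigma_algebraCD.
  by rewrite setDIr setDv set0U.
- move=> A gA; rewrite setI_bigcupr; exact: gen_bigcup.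
Qed.

Lemma good_square_grid : good_grid square_grid.
Proof.
split.
- by move=> k; apply: finite_image; exact: finite_II.
- move=> k _ [j jk <-]; split; [exact: interval_is_interval|exact: sqitv_unit|].
  exact: len_sqitv_gt0.
- move=> k _ _ [i ik <-] [j jk <-] ij.
  rewrite (_ : _ `&` _ = set0) ?measure0//; apply/seteqP; split => // x [/= a b].
  by apply: ij; rewrite (sqitv_cap_eq a b).
- move=> k; apply: (@subset_measure0 _ _ _ mu _ [set 0]).
  + apply: measurableD; first exact: measurable_itv.
    rewrite bigcup_image; apply: bigcup_measurable => j _; exact: measurable_sqitv.
  + exact: measurable_set1.
  + move=> x [/=]; rewrite /unit_itv/= in_itv/= => /andP[x0 x1] nx.
    apply/eqP; rewrite eq_le x0 andbT leNgt; apply/negP => xp; apply: nx.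
    by have [j jk xj] := sqitv_cover k xp x1; exists (sqitv k j) => //; exists j.
  + exact: lebesgue_measure_set1.
- move=> k _ [j /= jk <-]; exists (sqitv k j./2); last exact: sqitv_half.
  by exists j./2 => //=; move: jk; rewrite expnS; lia.
- move=> B mB BU; exists B; last by rewrite setYK measure0.
  by have := gen_borel mB; rewrite setIidr.
(* The children of interval [j] have indices [2 j] and [2 j + 1], with ratios
   [(4 j + 1) / (4 (2 j + 1))] and [(4 j + 3) / (4 (2 j + 1))]; both bounds are attained at
   [j = 0]. *)
exists (4^-1), (3/4); split; [lra|lra|].
move=> k _ _ [i _ <-] [j _ <-] sub; rewrite !len_sqitv.
have ij : i./2 = j.
  apply: (@sqitv_cap_eq k _ _ (sqpt k.+1 i.+1)).
    by apply: sqitv_half; exact: sqitv_right.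
  by apply: sub; exact: sqitv_right.
have -> : i.*2.+1%:R / 4 ^+ k.+1 / (j.*2.+1%:R / 4 ^+ k) =
    i.*2.+1%:R / (4 * j.*2.+1%:R) :> R.
  rewrite exprS; have : 0 < 4 ^+ k :> R by rewrite exprn_gt0.
  have : 0 < j.*2.+1%:R :> R by [].
  move: (4 ^+ k) (i.*2.+1%:R) (j.*2.+1%:R) => e u v uv_gt0 e_gt0.
  by field; rewrite !gt_eqF.
rewrite ler_pdivlMr// ler_pdivrMr// mulKf ?pnatr_eq0//.
rewrite mulrA (_ : 3 / 4 * 4 = 3); last by field.
by rewrite -natrM !ler_nat; apply/andP; split; lia.
Qed.

Lemma quasisymmetric_square_grid : quasisymmetric_grid square_grid.
Proof.
split; first exact: good_square_grid.
(* Touching intervals have indices that differ by at most 1, and the ratio [(2 j + 1) / (2 i + 1)]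
   is then extreme for the indices 0 and 1. *)
exists 3; first lra.
move=> k _ _ [i _ <-] [j _ <-] [x [xi xj]].
have H l : closure (sqitv k l) `<=` `[sqpt k l, sqpt k l.+1]%classic.
  rewrite [X in _ `<=` X](closure_id _).1; last exact: interval_closed.
  by apply: closure_subset; exact: subset_itv_oc_cc.
move: (H _ _ xi) (H _ _ xj); rewrite /= !in_itv/= => /andP[a b] /andP[c d].
have := le_trans a d; have := le_trans c b; rewrite !ler_sqpt => ji ij.
rewrite !len_sqitv.
have -> : j.*2.+1%:R / 4 ^+ k / (i.*2.+1%:R / 4 ^+ k) =
    j.*2.+1%:R / i.*2.+1%:R :> R.
  have : 0 < 4 ^+ k :> R by rewrite exprn_gt0.
  have : 0 < i.*2.+1%:R :> R by [].
  move: (4 ^+ k) (i.*2.+1%:R) (j.*2.+1%:R) => e u v uv_gt0 e_gt0.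
  by field; rewrite !gt_eqF.
rewrite ler_pdivlMr// ler_pdivrMr// mulrC ler_pdivrMr//.
by rewrite -!natrM !ler_nat; apply/andP; split; lia.
Qed.

End SquareGrid.
Arguments sqpt : clear implicits.
Arguments sqitv : clear implicits.
Arguments square_grid : clear implicits.
Arguments sqitv_right : clear implicits.

(** * Sums of atoms over disjoint cells *)

Section TestFunction.
Variables (R : realType) (c : nat -> R) (lev : nat -> nat).
Hypotheses (c0 : c 0%N = 0) (c_itv : forall m, 0 <= c m <= 1).
Hypothesis lev_ge : forall m, (m.+2 <= lev m)%N.
Local Notation mu := (@lebesgue_measure R).
Local Notation meas := (@measurable _ (measurableTypeR R)).

(* The member of level [lev m] with left endpoint [4 ^- m]. For [m = 0] it lies
   outside [0, 1], whence the hypothesis [c 0 = 0]. *)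
Definition cell (m : nat) : set R := sqitv R (lev m) (2 ^ (lev m - m)).

Let lev_lt m : (m < lev m)%N.
Proof. by have := lev_ge m; lia. Qed.

Let lev_leq m : (m <= lev m)%N.
Proof. exact: ltnW. Qed.

Let pow_lev m : 2 ^+ (lev m - m) / 4 ^+ lev m = 2 ^- lev m * 2 ^- m :> R.
Proof.
have -> : 4 = 2 * 2 :> R by ring.
rewrite exprMn -{2}(subnK (lev_leq m)) exprD; field.
by rewrite !expf_neq0.
Qed.

Lemma cell_left m : sqpt R (lev m) (2 ^ (lev m - m)) = 4 ^- m.
Proof.
rewrite sqptE -expnM mulnC expnM -{2}(subnK (lev_leq m)) exprD natrX.
by field; rewrite !expf_neq0.
Qed.

(** With [y = 2 ^ (lev m - m)], the upper bound amounts to [(y + 1) ^ 2 < 2 y ^ 2], true since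
    [lev_ge] gives [y >= 4]. As 2 is less than 4, the cells are disjoint. *)
Lemma cell_itv m x : cell m x -> 4 ^- m < x < 2 * 4 ^- m.
Proof.
rewrite /cell /sqitv/= in_itv/= -cell_left => /andP[-> /= h].
apply: (le_lt_trans h); rewrite !sqptE mulrA ltr_pM2r ?invr_gt0 ?exprn_gt0//.
rewrite -natrM ltr_nat.
have : (2 ^ 2 <= 2 ^ (lev m - m))%N by rewrite leq_exp2l//; have := lev_ge m; lia.
set y := (2 ^ (lev m - m))%N; nia.
Qed.

Lemma pow4_itv_eq (m l : nat) (x : R) : 4 ^- m <= x <= 2 * 4 ^- m ->
  4 ^- l <= x <= 2 * 4 ^- l -> m = l.
Proof.
have le (a b : nat) : 4 ^- a <= x <= 2 * 4 ^- a -> 4 ^- b <= x <= 2 * 4 ^- b ->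
    (a <= b)%N.
  move=> /andP[a1 a2] /andP[b1 b2]; rewrite leqNgt; apply/negP => ba.
  have : 4 * 4 ^- a <= 4 ^- b :> R.
    have -> : 4 * 4 ^- a = 4 ^- a.-1 :> R.
      by rewrite -{1}(ltn_predK ba) exprS; field; rewrite expf_neq0.
    rewrite lef_pV2 ?posrE ?exprn_gt0// ler_weXn2l ?ler1n//.
    by rewrite -ltnS (ltn_predK ba).
  have : 0 < 4 ^- a :> R by rewrite invr_gt0 exprn_gt0.
  lra.
by move=> h1 h2; apply/eqP; rewrite eqn_leq !le.
Qed.

Let cell_itvW m x : cell m x -> 4 ^- m <= x <= 2 * 4 ^- m.
Proof. by move=> /cell_itv/andP[/ltW -> /ltW ->]. Qed.

Lemma cell_eq m l x : cell m x -> cell l x -> m = l.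
Proof. by move=> /cell_itvW h1 /cell_itvW h2; exact: pow4_itv_eq h1 h2. Qed.

Lemma measurable_cell m : meas (cell m).
Proof. exact: measurable_sqitv. Qed.

Lemma cell_inj m l : cell m = cell l -> m = l.
Proof.
move=> H; have := sqitv_right R (lev m) (2 ^ (lev m - m)).
rewrite -/(cell m) => h; apply: (cell_eq h); by rewrite -H.
Qed.

Lemma len_cell_le m : len (cell m) <= 4 * (2 ^- lev m * 2 ^- m).
Proof.
rewrite len_sqitv -pow_lev mulrA ler_pM2r ?invr_gt0 ?exprn_gt0//.
rewrite -natrX -natrM ler_nat.
have : (0 < 2 ^ (lev m - m))%N by rewrite expn_gt0.
by set y := (2 ^ (lev m - m))%N; lia.
Qed.

(* The cells are disjoint, so this series has at most one nonzero term. *)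
Definition cellwise (w : nat -> R) (x : R) : R :=
  fine (\sum_(0 <= m <oo) (w m * \1_(cell m) x)%:E)%E.

Lemma nneseries_single (u : nat -> \bar R) m0 : (forall m, (0 <= u m)%E) ->
  (forall m, m != m0 -> u m = 0%E) -> (\sum_(0 <= m <oo) u m = u m0)%E.
Proof.
move=> u0 uz; rewrite (@nneseriesD1 _ _ m0)//= eseries0 ?adde0//.
by move=> i _ /uz.
Qed.

Lemma cellwise_series (w : nat -> R) x m : (forall m, 0 <= w m) -> cell m x ->
  (\sum_(0 <= m <oo) (w m * \1_(cell m) x)%:E = (w m)%:E)%E.
Proof.
move=> w0 xm; rewrite (nneseries_single (m0 := m)).
- by rewrite indicE mem_set// mulr1.
- by move=> l; rewrite lee_fin mulr_ge0.
move=> l lm; rewrite indicE memNset ?mulr0// => xl.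
by move/eqP: lm; apply; rewrite (cell_eq xl xm).
Qed.

Lemma cellwise_series0 (w : nat -> R) x : (forall m, ~ cell m x) ->
  (\sum_(0 <= m <oo) (w m * \1_(cell m) x)%:E = 0)%E.
Proof.
by move=> nx; rewrite eseries0// => m _ _; rewrite indicE memNset ?mulr0.
Qed.

Lemma cellwiseE w x m : (forall m, 0 <= w m) -> cell m x -> cellwise w x = w m.
Proof. by move=> w0 xm; rewrite /cellwise (cellwise_series w0 xm). Qed.

Lemma cellwise0 w x : (forall m, ~ cell m x) -> cellwise w x = 0.
Proof. by move=> nx; rewrite /cellwise cellwise_series0. Qed.

Lemma cellP x : (exists m, cell m x) \/ (forall m, ~ cell m x).
Proof.
have [h|h] := pselect (exists m, cell m x); first by left.
by right=> m xm; apply: h; exists m.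
Qed.

Lemma measurable_cellwise w D : (forall m, 0 <= w m) ->
  measurable_fun D (cellwise w).
Proof.
move=> w0; apply: measurable_funTS.
apply: (measurableT_comp (fine_measurable measurableT)).
apply: ge0_emeasurable_sum => m //=.
  by move=> x _ _; rewrite lee_fin mulr_ge0.
move=> _; apply/measurable_EFinP; apply: measurable_funM => //.
by apply: measurable_indic; exact: measurable_cell.
Qed.

(** The cells are disjoint, so the power acts on each term of the series. The integral sees only the
    part of a cell inside [0, 1], whence an inequality. *)
Lemma integral_cellwise_powR w p : 0 < p -> (forall m, 0 <= w m) ->
  (\int[mu]_(x in unit_itv R) (cellwise w x `^ p)%:E <=
   \sum_(0 <= m <oo) (w m `^ p * len (cell m))%:E)%E.
Proof.
move=> p0 w0.
have wp0 m : 0 <= w m `^ p by exact: powR_ge0.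
have mU := measurable_unit_itv R.
have -> : (\int[mu]_(x in unit_itv R) (cellwise w x `^ p)%:E =
    \int[mu]_(x in unit_itv R)
      \sum_(0 <= m <oo) (w m `^ p * \1_(cell m) x)%:E)%E.
  apply: eq_integral => x _; have [[m xm]|nx] := cellP x.
    by rewrite (cellwiseE w0 xm) (cellwise_series wp0 xm).
  by rewrite cellwise0// powR0 ?gt_eqF// (cellwise_series0 _ nx).
rewrite integral_nneseries//; last 2 first.
- move=> m; apply/measurable_EFinP; apply: measurable_funM => //.
  by apply: measurable_indic; exact: measurable_cell.
- by move=> m x _; rewrite lee_fin mulr_ge0.
apply: lee_nneseries => [m _ _|m _].
  by apply: integral_ge0 => x _; rewrite lee_fin mulr_ge0.
under eq_integral do rewrite EFinM.
rewrite ge0_integralZl//; last 2 first.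
- by apply/measurable_EFinP; apply: measurable_indic; exact: measurable_cell.
- by rewrite lee_fin.
rewrite integral_indic//; last exact: measurable_cell.
rewrite EFinM lee_wpmul2l ?lee_fin// /len /cell lebesgue_measure_sqitv/=.
rewrite -lebesgue_measure_sqitv; apply: le_measure.
- by rewrite inE; apply: measurableI => //; exact: measurable_sqitv.
- by rewrite inE; exact: measurable_sqitv.
exact: subIsetl.
Qed.

Variables (p s : R).
Hypotheses (p1 : 1 <= p) (s0 : 0 < s).

Let p_gt0 : 0 < p. Proof. exact: lt_le_trans p1. Qed.

Definition height (m : nat) : R := c m * len (cell m) `^ (s - p^-1).

(** The selection [A] lets one construction serve for a level of the series, for its remainders and
    for its sum. *)
Definition heights (A : pred nat) (m : nat) : R := if A m then height m else 0.

Lemma heights_ge0 A m : 0 <= heights A m.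
Proof.
rewrite /heights /height; case: ifP => // _.
by rewrite mulr_ge0 ?powR_ge0//; case/andP: (c_itv m).
Qed.

(** The exponent [s - 1/p] of the atoms leaves [len (cell m) ^ (s p)], to which [len_cell_le]
    applies. *)
Lemma height_powR_le m : height m `^ p * len (cell m) <=
  4 `^ (s * p) * (2 `^ (- (s * p))) ^+ lev m * (2 `^ (- (s * p))) ^+ m.
Proof.
have /andP[cm0 cm1] := c_itv m.
have l0 : 0 < len (cell m) by exact: len_sqitv_gt0.
rewrite -!exprVn_powR -!powRM ?invr_ge0 ?mulr_ge0 ?invr_ge0 ?exprn_ge0//.
rewrite /height powRM ?powR_ge0//.
have -> : (len (cell m) `^ (s - p^-1)) `^ p = len (cell m) `^ (s * p) / len (cell m).
  rewrite -powRrM mulrBl mulVf ?gt_eqF// powRB; last by rewrite (gt_eqF l0) implybT.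
  by rewrite powRr1// ltW.
rewrite -mulrA divfK ?gt_eqF//.
apply: (@le_trans _ _ (1 * len (cell m) `^ (s * p))).
  rewrite ler_wpM2r ?powR_ge0//.
  rewrite -[leRHS](congr1 (fun f => f p) (powR1 R)).
  by apply: ge0_ler_powR; rewrite ?nnegrE// ltW.
rewrite mul1r; apply: ge0_ler_powR.
- exact: mulr_ge0 (ltW s0) (ltW p_gt0).
- by rewrite nnegrE ltW.
- by rewrite nnegrE !mulr_ge0 ?invr_ge0 ?exprn_ge0.
- by rewrite -mulrA len_cell_le.
Qed.

(** In [height_powR_le], the factor in [m] is summed as a geometric series and the factor in [lev m]
    is bounded by its value at [n]. The estimate is thus as good for a whole remainder as for a
    single level. *)
Lemma Lp_norm_cellwise_le : exists2 K, 0 <= K &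
  forall (A : pred nat) n, (forall m, A m -> (n <= lev m)%N) ->
  (Lp_norm p (fun x => (cellwise (heights A) x)%:C)
    <= (K * (2 `^ (- s)) ^+ n)%:E)%E.
Proof.
have sp0 : 0 < s * p by rewrite mulr_gt0.
have z01 := powR2N_itv sp0; set z := 2 `^ (- (s * p)) in z01.
have /andP[z0 z1] := z01.
have B0 : 0 <= 4 `^ (s * p) * (1 - z)^-1.
  by rewrite mulr_ge0 ?powR_ge0// invr_ge0 subr_ge0 ltW.
exists ((4 `^ (s * p) * (1 - z)^-1) `^ p^-1); first exact: powR_ge0.
move=> A n An; have h0 := heights_ge0 A.
have le : (Lp_norm p (fun x => (cellwise (heights A) x)%:C) `^ p <=
    (4 `^ (s * p) * (1 - z)^-1 * z ^+ n)%:E)%E.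
  rewrite Lp_normX//.
  have -> : (\int[mu]_(x in unit_itv R)
        (Normc.normc (cellwise (heights A) x)%:C `^ p)%:E =
      \int[mu]_(x in unit_itv R) (cellwise (heights A) x `^ p)%:E)%E.
    apply: eq_integral => x _; rewrite normc_real ger0_norm//.
    have [[m xm]|nx] := cellP x; first by rewrite (cellwiseE h0 xm).
    by rewrite cellwise0.
  apply: (le_trans (integral_cellwise_powR p_gt0 h0)).
  apply: lime_le.
    apply: is_cvg_nneseries => m _ _.
    by rewrite lee_fin mulr_ge0 ?powR_ge0 ?ltW ?len_sqitv_gt0.
  apply: nearW => N; rewrite big_mkord sumEFin lee_fin.
  apply: (@le_trans _ _ (\sum_(m < N) 4 `^ (s * p) * z ^+ n * z ^+ m)).
    apply: ler_sum => m _; rewrite /heights; case: ifP => [/An nm|_]; last first.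
      by rewrite powR0 ?gt_eqF// mul0r !mulr_ge0 ?powR_ge0 ?exprn_ge0.
    apply: (le_trans (height_powR_le m)); rewrite -/z.
    rewrite ler_wpM2r ?exprn_ge0// ler_wpM2l ?powR_ge0//.
    by rewrite ler_wiXn2l// ltW.
  rewrite -mulr_sumr -mulrA -[leRHS]mulrA [(1 - z)^-1 * _]mulrC !mulrA.
  by rewrite ler_wpM2l ?mulr_ge0 ?powR_ge0 ?exprn_ge0// sum_geometric_le.
have N0 : (0 <= Lp_norm p (fun x => (cellwise (heights A) x)%:C))%E.
  exact: Lnorm_ge0.
have -> : Lp_norm p (fun x => (cellwise (heights A) x)%:C) =
    ((Lp_norm p (fun x => (cellwise (heights A) x)%:C) `^ p) `^ p^-1)%E.
  by rewrite -poweRrM mulfV ?gt_eqF// poweRe1.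
have E : (2 `^ (- s)) ^+ n = (z ^+ n) `^ p^-1 :> R.
  by rewrite exprn_powR// /z -powRrM; congr (_ `^ _ ^+ n); field; rewrite gt_eqF.
rewrite E -powRM ?exprn_ge0// -poweR_EFin.
apply: gt0_ler_poweR => //.
- by rewrite invr_ge0 ltW.
- by rewrite in_itv/= poweR_ge0 leey.
- by rewrite in_itv/= leey lee_fin mulr_ge0 ?exprn_ge0.
Qed.

(** Coefficients are functions of the interval itself, so the index of a cell is recovered by
    choice; [cell_inj] makes it unique. *)
Definition cell_coef (Q : set R) : R[i] :=
  if pselect (exists m, Q = cell m) is left h then (c (sval (cid h)))%:C else 0.

Lemma cell_coefE m : cell_coef (cell m) = (c m)%:C.
Proof.
rewrite /cell_coef; case: pselect => [h|[]]; last by exists m.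
by rewrite -(cell_inj (svalP (cid h))).
Qed.

Lemma cell_coef_cases (k j : nat) : (j < 2 ^ k)%N ->
  cell_coef (sqitv R k j) = 0 \/
  exists m, [/\ (0 < m)%N, lev m = k, j = (2 ^ (k - m))%N &
    cell_coef (sqitv R k j) = (c m)%:C].
Proof.
move=> jk; have [[m E]|h] := pselect (exists m, sqitv R k j = cell m); last first.
  by left; rewrite /cell_coef; case: pselect.
right; exists m; have [km jm] := sqitv_inj E; rewrite E cell_coefE.
split; [|by []|by rewrite km|by []].
case: m {E} km jm => // km jm; move: jk; rewrite jm km subn0 ltnn//.
Qed.

Lemma level_cell_coef k x :
  level s p (square_grid R) cell_coef k x =
  (cellwise (heights (fun m => lev m == k)) x)%:C.
Proof.
rewrite /level fsbig_square_grid.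
have h0 := heights_ge0 (fun m => lev m == k).
have [[m [m0 mk xm]]|none] :=
    pselect (exists m, [/\ (0 < m)%N, lev m = k & cell m x]).
  rewrite (cellwiseE h0 xm) /heights mk eqxx.
  have jk : (2 ^ (k - m) < 2 ^ k)%N.
    by rewrite ltn_exp2l// -mk; have := lev_lt m; lia.
  have xQ : sqitv R k (2 ^ (k - m)) x by move: xm; rewrite /cell mk.
  rewrite (bigD1 (Ordinal jk))//= big1 ?addr0; last first.
    move=> j jm; rewrite /atom indicE memNset ?mulr0 ?mulr0//.
    by move=> xj; move/eqP: jm; apply; apply/val_inj/(sqitv_cap_eq xj xQ).
  have QE : sqitv R k (2 ^ (k - m)) = cell m by rewrite /cell mk.
  rewrite QE cell_coefE /atom indicE mem_set// mulr1 /height.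
  by rewrite -rmorphM.
rewrite big1 => [|j _].
  have [[m xm]|nx] := cellP x; last by rewrite cellwise0.
  rewrite (cellwiseE h0 xm) /heights; case: eqP => // mk.
  (* [cell 0] belongs to no level of the grid, and [c 0 = 0] makes the other side vanish on it. *)
  case: m xm mk => [|m] xm mk; first by rewrite /height c0 mul0r.
  by exfalso; apply: none; exists m.+1.
have [->|[m [m0 mk jm ->]]] := cell_coef_cases (ltn_ord j); first by rewrite mul0r.
rewrite /atom indicE memNset ?mulr0 ?mulr0// => xj.
by apply: none; exists m; split => //; rewrite /cell mk -jm.
Qed.

(** Each interval of the level is charged to the index [m] of its cell; after exchanging the sums,
    at most one [j] is left for each [m]. *)
Lemma coef_sum_cell_coef_le k :
  coef_sum p (square_grid R) cell_coef k <=
  \sum_(m < k | lev m == k) c m `^ p.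
Proof.
have p_neq0 : p != 0 by rewrite gt_eqF.
rewrite /coef_sum fsbig_square_grid.
apply: (@le_trans _ _ (\sum_(j < 2 ^ k) \sum_(m < k | lev m == k)
    (if val j == (2 ^ (k - m))%N then c m `^ p else 0))).
  apply: ler_sum => j _.
  have pos : 0 <= \sum_(m < k | lev m == k)
      (if val j == (2 ^ (k - m))%N then c m `^ p else 0).
    by apply: sumr_ge0 => m _; case: ifP => // _; exact: powR_ge0.
  have [->|[m [m0 mk jm ->]]] := cell_coef_cases (ltn_ord j).
    by rewrite Normc.normc0 powR0.
  rewrite normc_real ger0_norm; last by case/andP: (c_itv m).
  have mk' : (m < k)%N by rewrite -mk.
  rewrite (bigD1 (Ordinal mk'))/=; last by apply/eqP.
  rewrite {1}jm eqxx lerDl; apply: sumr_ge0 => l _; case: ifP => // _; exact: powR_ge0.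
rewrite exchange_big/=; apply: ler_sum => m _.
rewrite -big_mkcond/=; have cp := powR_ge0 (c m) p.
have [jk|jk] := ltnP (2 ^ (k - m)) (2 ^ k).
  by rewrite (big_pred1 (Ordinal jk))// => j; rewrite -val_eqE.
by rewrite big_pred0// => j; apply/negbTE; rewrite neq_ltn (leq_trans (ltn_ord j)).
Qed.

(** Both convergences come from [Lp_norm_cellwise_le]: level [k] has norm at most [K * y ^ k], and
    the remainder after [N] levels, which is the sum over the cells with [N <= lev m], at most
    [K * y ^ N]. *)
Lemma besov_grid_cellwise q : (coef_norm p q (square_grid R) cell_coef < +oo)%E ->
  besov_grid s p q (square_grid R) (fun x => (cellwise (heights xpredT) x)%:C).
Proof.
move=> cfin; have [K K0 HK] := Lp_norm_cellwise_le.
have y01 := powR2N_itv s0; set y := 2 `^ (- s) in HK y01.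
have /andP[y0 y1] := y01.
split.
  split.
  - by rewrite /=; apply: measurable_cellwise; exact: heights_ge0.
  - by rewrite /=; exact: measurable_cst.
  - by apply: (le_lt_trans (HK xpredT 0%N _)) => //; rewrite ltry.
exists cell_coef; split => //.
  apply: (@le_lt_trans _ _ (K * (1 - y)^-1)%:E); last exact: ltry.
  apply: lime_le; first by apply: is_cvg_nneseries => k _ _; exact: Lnorm_ge0.
  apply: nearW => N; rewrite big_mkord.
  apply: (@le_trans _ _ (\sum_(k < N) (K * y ^+ k)%:E)%E).
    apply: lee_sum => k _.
    rewrite (_ : level _ _ _ _ _ =
      (fun x => (cellwise (heights (fun m => lev m == k)) x)%:C)); last first.
      by apply/funext => x; exact: level_cell_coef.
    by apply: HK => m /eqP ->.
  by rewrite sumEFin lee_fin -mulr_sumr ler_wpM2l// sum_geometric_le.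
have E N : (fun x => (cellwise (heights xpredT) x)%:C -
      \sum_(k < N) level s p (square_grid R) cell_coef k x) =
    (fun x => (cellwise (heights (fun m => (N <= lev m)%N)) x)%:C).
  apply/funext => x; under eq_bigr do rewrite level_cell_coef.
  rewrite -rmorph_sum -rmorphB; congr _%:C.
  have [[m xm]|nx] := cellP x; last first.
    rewrite !(cellwise0 _ nx) big1 ?subrr// => k _.
    by rewrite (cellwise0 _ nx).
  rewrite !(cellwiseE (heights_ge0 _) xm).
  under eq_bigr do rewrite (cellwiseE (heights_ge0 _) xm).
  rewrite /heights; case: leqP => mN.
    rewrite big1 ?subr0// => k _; case: eqP => // mk.
    by have := ltn_ord k; rewrite -mk ltnNge mN.
  rewrite (bigD1 (Ordinal mN))//= eqxx big1 ?addr0 ?subrr// => k.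
  by rewrite -val_eqE/= eq_sym => /negbTE ->.
under eq_fun do rewrite E.
apply: (@squeeze_cvge _ _ _ _ (fun=> 0%E) _ (fun N => (K * y ^+ N)%:E)).
- apply: nearW => N; rewrite Lnorm_ge0/=; exact: HK.
- exact: cvg_cst.
- apply: cvg_EFin; first by apply: nearW.
  rewrite -(mulr0 K); apply: cvgMr; apply: cvg_expr.
  by rewrite ger0_norm.
Qed.

End TestFunction.

(** * Lower bound for the Haar coefficients of the test function *)

Section HaarLowerBound.
Variables (R : realType) (c : nat -> R) (lev : nat -> nat).
Hypotheses (c_itv : forall m, 0 <= c m <= 1).
Hypothesis lev_ge : forall m, (m.+2 <= lev m)%N.
Variables (p s : R).
Hypothesis sp : s < p^-1.
Local Notation mu := (@lebesgue_measure R).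
Local Notation Q := (@cell R lev).
Local Notation f := (cellwise lev (heights c lev p s xpredT)).

(** The dyadic interval of this level and position has the left endpoint of the cell. The cell
    covers its left half and only a small piece of its right half, so little cancels. The cell is
    shorter than the dyadic interval, hence, as [s < 1/p], its atom is at least as high as the
    dyadic one. *)
Lemma haar_cellwise_ge m :
  c m * (2 ^- (lev m + m - 2)) `^ (1 + (s - p^-1)) / 4 <=
  haar (lev m + m - 2) (2 ^ (lev m - m - 2)) f.
Proof.
set n := (lev m + m - 2)%N; set i := (2 ^ (lev m - m - 2))%N.
have levm := lev_ge m.
have /andP[cm0 cm1] := c_itv m.
(* In units of [E] the cell is []A ^ 2, (A + 1) ^ 2]], and the dyadic interval is
   [[A ^ 2, A ^ 2 + 4 A]] with midpoint [A ^ 2 + 2 A]. *)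
pose A : R := 2 ^+ (lev m - m); pose E : R := 4 ^- lev m.
have E0 : 0 < E by rewrite invr_gt0 exprn_gt0.
have A4 : 4 <= A.
  have -> : 4 = 2 ^+ 2 :> R by ring.
  by rewrite ler_weXn2l ?ler1n//; lia.
have iA : i%:R = A / 4 :> R.
  rewrite /i /A natrX {2}(_ : lev m - m = (lev m - m - 2).+2)%N; last by lia.
  by rewrite !exprS; field.
have AE : A ^+ 2 * E = 4 ^- m.
  rewrite -(cell_left R lev_ge) sqptE /A natrX -exprM mulnC.
  by rewrite exprM natrX -!exprM mulnC.
have nE : 2 ^- n.+1 = 2 * A * E.
  rewrite /A /E.
  have -> : 4 ^+ lev m = 2 ^+ lev m * 2 ^+ lev m :> R.
    by rewrite -exprMn; congr (_ ^+ _); ring.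
  have h : (2 ^+ lev m : R) = 2 ^+ (lev m - m) * 2 ^+ m.
    by rewrite -exprD subnK//; lia.
  have h' : (2 ^+ n.+1 : R) * 2 = 2 ^+ lev m * 2 ^+ m.
    by rewrite -exprSr -exprD; congr (_ ^+ _); rewrite /n; lia.
  have -> : (2 ^+ n.+1 : R) = 2 ^+ lev m * 2 ^+ m / 2 by rewrite -h' mulfK.
  rewrite h; have := exprn_gt0 (lev m - m) (ltr0n R 2).
  have := exprn_gt0 m (ltr0n R 2).
  move: (2 ^+ m) (2 ^+ (lev m - m)) => a b a0 b0.
  by field; rewrite !gt_eqF.
have left : (i.*2)%:R * 2 ^- n.+1 = A ^+ 2 * E.
  by rewrite -muln2 natrM iA nE; field.
have mid : (i.*2.+1)%:R * 2 ^- n.+1 = (A ^+ 2 + 2 * A) * E.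
  by rewrite -[i.*2.+1]addn1 natrD mulrDl left nE; ring.
have right : (i.*2.+2)%:R * 2 ^- n.+1 = (A ^+ 2 + 4 * A) * E.
  by rewrite -[i.*2.+2]addn1 natrD mulrDl mid nE; ring.
have cellE : Q m = `]A ^+ 2 * E, (A + 1) ^+ 2 * E]%classic.
  rewrite /cell /sqitv; set a := (2 ^ (lev m - m))%N.
  have aA : a%:R = A by rewrite /a natrX.
  have -> : sqpt R (lev m) a = A ^+ 2 * E by rewrite sqptE natrX aA.
  suff -> : sqpt R (lev m) a.+1 = (A + 1) ^+ 2 * E by [].
  by rewrite sqptE natrX -[a.+1]addn1 natrD aA.
(* Since [A >= 4], the endpoint [A ^ 2 + 4 A] is at most [2 A ^ 2], so no cell other than [cell m]
   meets the dyadic interval. *)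
have val j x : (j = i.*2 \/ j = i.*2.+1) -> dyadic R n.+1 j x ->
    f x = heights c lev p s xpredT m * \1_(Q m) x.
  move=> hj xj.
  have xm : 4 ^- m <= x <= 2 * 4 ^- m.
    rewrite -AE; move: xj; rewrite /dyadic/= in_itv/=.
    case: hj => ->; rewrite ?left ?mid ?right => /andP[a b]; apply/andP; split;
      nra.
  have h0 := heights_ge0 lev c_itv p s xpredT.
  have [[l xl]|nx] := cellP lev x; last by rewrite cellwise0// indicE memNset ?mulr0.
  have lm : l = m.
    apply: (pow4_itv_eq _ xm).
    by have /andP[a b] := cell_itv lev_ge xl; rewrite !ltW.
  by rewrite (cellwiseE lev_ge h0 xl) lm indicE mem_set ?mulr1// -lm.
have int j : (j = i.*2 \/ j = i.*2.+1) ->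
    \int[mu]_(x in dyadic R n.+1 j) f x =
    heights c lev p s xpredT m * fine (mu (Q m `&` dyadic R n.+1 j)).
  move=> hj; rewrite -Rintegral_indic//; last exact: measurable_cell.
  rewrite -RintegralZl//; last first.
    apply: integrable_indic_finite => //; first exact: measurable_cell.
    by rewrite lebesgue_measure_dyadic ltry.
  by apply: eq_Rintegral => x /set_mem; exact: val.
rewrite /haar !int; [|by right|by left].
have -> : Q m `&` dyadic R n.+1 i.*2 =
    `]A ^+ 2 * E, (A ^+ 2 + 2 * A) * E]%classic.
  rewrite cellE /dyadic left mid; apply/seteqP; split => x /=; rewrite !in_itv/=.
    by move=> [/andP[-> _] /andP[_ ->]].
  move=> /andP[a b]; rewrite a b (ltW a)/=; split => //; apply: (le_trans b); nra.
have -> : Q m `&` dyadic R n.+1 i.*2.+1 =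
    `[(A ^+ 2 + 2 * A) * E, (A + 1) ^+ 2 * E]%classic.
  rewrite cellE /dyadic mid right; apply/seteqP; split => x /=; rewrite !in_itv/=.
    by move=> [/andP[_ ->] /andP[-> _]].
  move=> /andP[a b]; rewrite a b/= ?andbT; split.
    by apply: lt_le_trans a; nra.
  apply: (le_trans b); nra.
rewrite !lebesgue_measure_itv/= !lte_fin !ifT; [|nra|nra].
rewrite -!EFinB/= -mulrBr.
(* Finally [2 A - 1 >= A], and [A * E] is a quarter of the dyadic length, whence the constant 4. *)
have -> : (A ^+ 2 + 2 * A) * E - A ^+ 2 * E -
    ((A + 1) ^+ 2 * E - (A ^+ 2 + 2 * A) * E) = (2 * A - 1) * E by ring.
have nE4 : 2 ^- n = 4 * (A * E).
  have -> : 2 ^- n = 2 * 2 ^- n.+1 :> R.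
    by rewrite exprS; field; rewrite expf_neq0.
  by rewrite nE; ring.
rewrite /heights /height.
have l0 : 0 < len (Q m) by exact: len_sqitv_gt0.
have n0 : 0 < 2 ^- n :> R by rewrite invr_gt0 exprn_gt0.
have lle : len (Q m) <= 2 ^- n.
  rewrite cellE /len lebesgue_measure_itv/= lte_fin ifT; last by nra.
  by rewrite -EFinB/= nE4; nra.
have pw : (2 ^- n) `^ (s - p^-1) <= len (Q m) `^ (s - p^-1).
  rewrite -(opprB p^-1 s) !powRN lef_pV2 ?posrE ?powR_gt0//.
  by apply: ge0_ler_powR; rewrite ?nnegrE ?subr_ge0// ltW.
have -> : (2 ^- n) `^ (1 + (s - p^-1)) = 2 ^- n * (2 ^- n) `^ (s - p^-1) :> R.
  rewrite [LHS]powRD; last by rewrite (gt_eqF n0) implybT.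
  by rewrite powRr1// ltW.
rewrite {1}nE4.
have -> : c m * (4 * (A * E) * (2 ^- n) `^ (s - p^-1)) / 4 =
  c m * (2 ^- n) `^ (s - p^-1) * (A * E) by field.
apply: ler_pM; rewrite ?mulr_ge0 ?powR_ge0//.
- by apply: (le_trans _ A4).
- exact: ltW.
- by rewrite ler_wpM2l.
- by rewrite ler_wpM2r ?(ltW E0)//; lra.
Qed.

End HaarLowerBound.

(** * Separating exponents *)

Section Cases.
Variable R : realType.
Implicit Types (p s q r w : R).

(** With [w = 2 ^ (- 1/r)] this is [m ^ (- 1/r)], where [m] is rounded down to a power of 2. The
    value at 0 provides [c 0 = 0]. *)
Definition block_coef w (m : nat) : R :=
  if m == 0%N then 0 else w ^+ trunc_log 2 m.

Lemma block_coef_itv w : 0 <= w <= 1 -> forall m, 0 <= block_coef w m <= 1.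
Proof.
move=> /andP[w0 w1] m; rewrite /block_coef; case: ifP => _; first by rewrite lexx ler01.
by rewrite exprn_ge0//= exprn_ile1.
Qed.

Lemma block_coef_block w i m : (2 ^ i <= m < 2 ^ i.+1)%N ->
  block_coef w m = w ^+ i.
Proof.
move=> h; rewrite /block_coef (trunc_log_eq _ h)//; case: eqP => // m0.
by move: h; rewrite m0 leqn0 expn_eq0.
Qed.

(** Each nonzero [F k] is charged to some [i] with [K i = k], and each [i] is charged at most once.
    The condition [i <= k] keeps [i] below [N]. *)
Lemma sum_sparse_le (F G : nat -> R) (K : nat -> nat) N :
  (forall i, 0 <= G i) ->
  (forall k, F k = 0 \/ exists i, [/\ K i = k, (i <= k)%N & F k <= G i]) ->
  \sum_(k < N) F k <= \sum_(i < N) G i.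
Proof.
move=> G0 FG.
apply: (@le_trans _ _ (\sum_(k < N) \sum_(i < N) (if K i == k then G i else 0))).
  apply: ler_sum => k _.
  have pos (P : pred 'I_N) : 0 <= \sum_(i < N | P i) (if K i == k then G i else 0).
    by apply: sumr_ge0 => i _; case: ifP.
  have [->//|[i [Ki ik le]]] := FG k.
  have iN : (i < N)%N by exact: leq_ltn_trans ik (ltn_ord k).
  by rewrite (bigD1 (Ordinal iN))//= Ki eqxx (le_trans le)// lerDl.
rewrite exchange_big/=; apply: ler_sum => i _.
have [Ki|Ki] := ltnP (K i) N.
  rewrite (bigD1 (Ordinal Ki))//= eqxx big1 ?addr0// => k.
  by rewrite -val_eqE/= eq_sym => /negbTE ->.
rewrite big1// => k _; case: eqP => // E.
by have := ltn_ord k; rewrite -E ltnNge Ki.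
Qed.

Lemma coef_norm_lty p q (P : nat -> set (set R)) (c : set R -> R[i]) B : 0 < q ->
  (forall N, \sum_(k < N) coef_sum p P c k `^ (q / p) <= B) ->
  (coef_norm p q%:E P c < +oo)%E.
Proof.
move=> q0 H; rewrite /coef_norm; apply: poweR_lty.
apply: (@le_lt_trans _ _ B%:E); last exact: ltry.
apply: lime_le.
  by apply: is_cvg_nneseries => k _ _; rewrite lee_fin powR_ge0.
by apply: nearW => N; rewrite big_mkord sumEFin lee_fin; exact: H.
Qed.

Lemma coef_norm_infty_lty p (P : nat -> set (set R)) (c : set R -> R[i]) B :
  0 < p -> (forall k, coef_sum p P c k <= B) ->
  (coef_norm p +oo P c < +oo)%E.
Proof.
move=> p0 H; rewrite /coef_norm.
apply: (@le_lt_trans _ _ (B `^ p^-1)%:E); last exact: ltry.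
apply: ge_ereal_sup => _ [k _ <-]; rewrite lee_fin.
apply: ge0_ler_powR; rewrite ?nnegrE ?coef_sum_ge0//.
- by rewrite invr_ge0 ltW.
- by apply: le_trans (H 0%N); exact: coef_sum_ge0.
exact: H.
Qed.

Lemma powR2X_unbounded (e C : R) : 0 < e -> exists i : nat, C < (2 `^ e) ^+ i.
Proof.
move=> e0; pose k := (Num.trunc `|C|).+1.
have Ck : C < k%:R by apply: (le_lt_trans (ler_norm C)); exact: truncnS_gt.
have k2 : k%:R < 2 ^+ k :> R by rewrite -natrX ltr_nat ltn_expl.
pose i := (Num.trunc (k%:R / e)).+1; exists i.
have ki : k%:R / e < i%:R by exact: truncnS_gt.
apply: (lt_le_trans (lt_trans Ck k2)).
rewrite -[leRHS]powR_mulrn ?powR_ge0// -powRrM -powR_mulrn//.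
by rewrite ler_powR ?ler1n// mulrC -ler_pdivrMr// ltW.
Qed.

(** The comparison that ends both cases, between the sum over a block of [2 ^ i] equal coefficients
    and a Hoelder bound. Here [a] and [r] stand for reciprocals of exponents. *)
Lemma powR2_block_growth (a r C : R) i :
  2 ^+ i * (2 `^ (- r)) ^+ i <= C * (2 ^ i)%:R `^ (1 - a) ->
  (2 `^ (a - r)) ^+ i <= C.
Proof.
have E x : (2 `^ x) ^+ i = (2 ^ i)%:R `^ x :> R.
  by rewrite natrX exprn_powR.
have i0 : 0 < (2 ^ i)%:R :> R by rewrite ltr0n expn_gt0.
have D x y : (2 ^ i)%:R `^ (x + y) = (2 ^ i)%:R `^ x * (2 ^ i)%:R `^ y :> R.
  by rewrite powRD// (gt_eqF i0) implybT.
rewrite !E -natrX -{1}(powRr1 (ltW i0)) -D => H.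
rewrite -(@ler_pM2r _ ((2 ^ i)%:R `^ (1 - a))) ?powR_gt0// -D.
by rewrite (_ : a - r + (1 - a) = 1 - r)//; ring.
Qed.

Lemma sum_block_coef_powR w q N : 0 <= w -> 0 < q ->
  \sum_(m < 2 ^ N) block_coef w m `^ q = \sum_(i < N) (2 * w `^ q) ^+ i.
Proof.
move=> w0 q0; elim: N => [|N IH].
  by rewrite big_ord0 expn0 big_ord1/= /block_coef eqxx powR0 ?gt_eqF.
rewrite big_ord_recr/= -IH expnS mul2n -addnn big_split_ord/=; congr (_ + _).
rewrite (eq_bigr (fun=> (w ^+ N) `^ q)) => [|j _]; last first.
  rewrite (@block_coef_block _ N)// leq_addr/= expnS mul2n -addnn ltn_add2l.
  exact: ltn_ord.
by rewrite sumr_const card_ord -[LHS]mulr_natl natrX exprMn exprn_powR.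
Qed.

Lemma mem_block m : (0 < m)%N ->
  (2 ^ trunc_log 2 m <= m < 2 ^ (trunc_log 2 m).+1)%N.
Proof. by move=> m0; exact: trunc_log_bounds. Qed.

(* All the cells of the block [2 ^ i <= m < 2 ^ i.+1] are on pairwise distinct
   levels of the square grid, but of the size of a single dyadic level. *)
Definition shifted_lev (m : nat) : nat := (2 ^ (trunc_log 2 m).+2 + 2 - m)%N.

Lemma shifted_lev_ge m : (m.+2 <= shifted_lev m)%N.
Proof.
rewrite /shifted_lev; case: m => [|m]; first by rewrite trunc_log0.
have /andP[] := @mem_block m.+1 isT; rewrite !expnS; lia.
Qed.

(** The levels of block [t] lie strictly between [2 ^ (t + 1) + 2] and [2 ^ (t + 2) + 2], so
    distinct blocks do not interfere. *)
Lemma shifted_lev_inj m l : (0 < m)%N -> (0 < l)%N ->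
  shifted_lev m = shifted_lev l -> m = l.
Proof.
move=> m0 l0; rewrite /shifted_lev.
have := mem_block m0; have := mem_block l0.
set t := trunc_log 2 m; set u := trunc_log 2 l; rewrite !expnS.
case: (ltngtP t u) => [tu|ut|->]; last by lia.
  have := @leq_exp2l 2 t.+1 u isT; rewrite tu expnS; lia.
have := @leq_exp2l 2 u.+1 t isT; rewrite ut expnS; lia.
Qed.

Lemma double_block_itv i m : (2 ^ i <= m < 2 ^ i.+1)%N ->
  (0 < m.*2 < 2 ^ i.+2)%N.
Proof. by rewrite !expnS; have := expn_gt0 2 i; lia. Qed.

Lemma subn_double_inj n a b : (a.*2 < n)%N -> (b.*2 < n)%N ->
  (n - a.*2 = n - b.*2)%N -> a = b.
Proof. lia. Qed.

(** For [shifted_lev m = n + 2 - m], with [n = 2 ^ (i + 2)] on block [i], these are the level and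
    the exponent of the position in [haar_cellwise_ge]; the level does not depend on [m]. *)
Lemma spread_lev n m : (m.*2 < n)%N ->
  (n + 2 - m + m - 2 = n)%N /\ (n + 2 - m - m - 2 = n - m.*2)%N.
Proof. lia. Qed.

(** Used with [y = 2 ^ i], [z = 2 ^ (i + 1)] and the cell [m = n - z]: as [m] runs through the
    block, the Haar level [n] takes [y] consecutive values. *)
Lemma gather_lev y z n : (z = y + y)%N -> (z + y <= n < z + y + y)%N ->
  [/\ (y <= n - z < z)%N, (z + 2 + (n - z) - 2 = n)%N &
      (z + 2 - (n - z) - 2 = z - (n - z))%N].
Proof. by move=> -> h; split; lia. Qed.

(** * The case [p < r < q]: one cell per level of the square grid *)

Section Spread.
Variables (p s r : R) (q : \bar R).
Hypotheses (p1 : 1 <= p) (s0 : 0 < s) (sp : s < p^-1) (pr : p < r).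
Hypothesis rq : (r%:E < q)%E.

Let w := 2 `^ (- r^-1).
Let p0 : 0 < p. Proof. exact: lt_le_trans p1. Qed.
Let r0 : 0 < r. Proof. exact: lt_trans pr. Qed.
Let w01 : 0 <= w < 1. Proof. by apply: powR2N_itv; rewrite invr_gt0. Qed.
Let w0 : 0 <= w. Proof. by case/andP: w01. Qed.
Let c_itv : forall m, 0 <= block_coef w m <= 1.
Proof. by apply: block_coef_itv; rewrite w0/= ltW//; case/andP: w01. Qed.
Let c0 : block_coef w 0 = 0. Proof. by []. Qed.
Let C := coef_sum p (square_grid R) (cell_coef (block_coef w) shifted_lev).

(** By [shifted_lev_inj] a level holds at most one cell of positive index; the index 0 contributes
    nothing. *)
Let coef_sum_cases k : C k = 0 \/
  exists m, [/\ shifted_lev m = k, (m <= k)%N & C k <= block_coef w m `^ p].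
Proof.
have H := coef_sum_cell_coef_le c_itv shifted_lev_ge p1 k.
have [[m [m0 mk]]|none] := pselect (exists m, (0 < m)%N /\ shifted_lev m = k).
  right; exists m; have mk' : (m < k)%N by rewrite -mk ltnW// shifted_lev_ge.
  split => //; first exact: ltnW.
  apply: (le_trans H).
  rewrite (bigD1 (Ordinal mk'))/=; last by apply/eqP.
  rewrite big1 ?addr0// => l /andP[/eqP lk lm].
  have [l0|l0] := posnP l; first by rewrite l0 c0 powR0 ?gt_eqF.
  move/eqP: lm; case; apply: val_inj => /=; apply: shifted_lev_inj => //.
  by rewrite lk.
left; apply/eqP; rewrite eq_le coef_sum_ge0 andbT (le_trans H)// big1// => m /eqP mk.
have [m0|m0] := posnP m; first by rewrite m0 c0 powR0 ?gt_eqF.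
by exfalso; apply: none; exists m.
Qed.

(** As no two cells share a level, the norm is at most the l^q norm of [block_coef w]. For finite
    [q] this is governed by a geometric series of ratio [2 w ^ q = 2 ^ (1 - q/r)], less than 1
    because [r < q]. *)
Let coef_norm_fin : (coef_norm p q (square_grid R)
  (cell_coef (block_coef w) shifted_lev) < +oo)%E.
Proof.
move: q rq => [q'||//]; last first.
  move=> _; apply: (@coef_norm_infty_lty p _ _ 1) => // k.
  rewrite -/(C k).
  have [->//|[m [_ _ le]]] := coef_sum_cases k; apply: (le_trans le).
  have /andP[cm0 cm1] := c_itv m.
  rewrite -[leRHS](congr1 (fun f => f p) (powR1 R)).
  by apply: ge0_ler_powR; rewrite ?nnegrE// ltW.
rewrite lte_fin => rq'; have q0 : 0 < q' by exact: lt_trans rq'.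
have t01 : 0 <= 2 * w `^ q' < 1.
  have -> : 2 * w `^ q' = 2 `^ (- (q' / r - 1)) :> R.
    rewrite /w -powRrM -{1}(@powRr1 _ 2)// -powRD; last by rewrite pnatr_eq0 implybT.
    by congr (_ `^ _); ring.
  by apply: powR2N_itv; rewrite subr_gt0 ltr_pdivlMr// mul1r.
apply: (@coef_norm_lty p q' _ _ (1 - 2 * w `^ q')^-1) => // N.
apply: (@le_trans _ _ (\sum_(m < N) block_coef w m `^ q')).
  apply: (@sum_sparse_le (fun k => C k `^ (q' / p))
    (fun m => block_coef w m `^ q') shifted_lev N) => [m|k].
    exact: powR_ge0.
  have [Ck0|[m [mk km le]]] := coef_sum_cases k.
    left; rewrite Ck0 powR0// mulf_neq0 ?invr_eq0// gt_eqF//.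
  right; exists m; split => //.
  have -> : block_coef w m `^ q' = (block_coef w m `^ p) `^ (q' / p).
    by rewrite -powRrM; congr (_ `^ _); field; rewrite gt_eqF.
  apply: ge0_ler_powR; rewrite ?nnegrE ?powR_ge0 ?coef_sum_ge0//.
  by rewrite divr_ge0// ltW.
(* The sum is completed to whole blocks, which [sum_block_coef_powR] evaluates. *)
apply: (@le_trans _ _ (\sum_(m < 2 ^ N) block_coef w m `^ q')).
  have N2 : (N <= 2 ^ N)%N by rewrite ltnW// ltn_expl.
  rewrite -(big_mkord xpredT (fun m => block_coef w m `^ q')).
  rewrite -[leRHS](big_mkord xpredT (fun m => block_coef w m `^ q')).
  rewrite [leRHS](big_cat_nat (leq0n _) N2)/= lerDl.
  by apply: sumr_ge0 => m _; exact: powR_ge0.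
by rewrite sum_block_coef_powR// sum_geometric_le.
Qed.

(** Block [i] shows up in [2 ^ i] Haar coefficients of the single level [2 ^ (i + 2)], at distinct
    positions. Up to a common factor their sum is at least of order [2 ^ (i (1 - 1/r))], whereas
    [besov_haar_sum_le] allows [2 ^ (i (1 - 1/p))]; since [p < r], this fails for large [i]. *)
Lemma square_grid_not_besov_lt :
  exists2 f, besov_grid s p q (square_grid R) f & ~ besov s p q f.
Proof.
pose g := cellwise shifted_lev (heights (block_coef w) shifted_lev p s xpredT).
exists (fun x => (g x)%:C).
  exact (@besov_grid_cellwise R (block_coef w) shifted_lev c0 c_itv
    shifted_lev_ge p s p1 s0 q coef_norm_fin).
have q1 : (1 <= q)%E.
  by apply: le_trans (ltW rq); rewrite lee_fin (le_trans p1)// ltW.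
move=> /(besov_haar_sum_le p1 q1 s0)[B B0 HB].
have e0 : 0 < p^-1 - r^-1 by rewrite subr_gt0 ltf_pV2.
have [i /negP] : exists i, ~~ ((2 `^ (p^-1 - r^-1)) ^+ i <= 4 * B).
  by have [i Hi] := powR2X_unbounded (4 * B) e0; exists i; rewrite -ltNge.
apply; apply: powR2_block_growth.
set n := (2 ^ i.+2)%N.
pose ix m := (2 ^ (n - m.*2))%N.
pose I := [seq ix m | m <- index_iota (2 ^ i) (2 ^ i.+1)].
have mI m : m \in index_iota (2 ^ i) (2 ^ i.+1) -> (2 ^ i <= m < 2 ^ i.+1)%N.
  by rewrite mem_index_iota.
have mn m : m \in index_iota (2 ^ i) (2 ^ i.+1) -> (0 < m.*2 < n)%N.
  by move=> /mI; exact: double_block_itv.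
have uI : uniq I.
  rewrite map_inj_in_uniq ?iota_uniq// => m l /mn mh /mn lh /eqP.
  case/andP: mh lh => _ mh /andP[_ lh].
  by rewrite /ix eqn_exp2l// => /eqP; exact: subn_double_inj.
have ltI : {in I, forall j, (j < 2 ^ n)%N}.
  move=> _ /mapP[m /mn/andP[m0 mh] ->]; rewrite /ix ltn_exp2l// ltn_subrL m0.
  exact: leq_ltn_trans mh.
have := HB n I uI ltI.
have -> : size I = (2 ^ i)%N by rewrite size_map size_iota expnS mul2n -addnn addnK.
rewrite big_map; set D := (2 ^- n) `^ (1 + (s - p^-1)) => H.
have D0 : 0 < D by rewrite powR_gt0// invr_gt0 exprn_gt0.
have low : 2 ^+ i * (w ^+ i * D / 4) <= B * (2 ^ i)%:R `^ (1 - p^-1) * D.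
  apply: le_trans H.
  have -> : 2 ^+ i * (w ^+ i * D / 4) =
      \sum_(2 ^ i <= m < 2 ^ i.+1) (w ^+ i * D / 4).
    rewrite sumr_const_nat -[RHS]mulr_natl -natrX; congr (_%:R * _).
    by rewrite expnS mul2n -addnn addnK.
  rewrite !big_seq; apply: ler_sum => m mB.
  have mb := mI _ mB; have /andP[_ /spread_lev[nE1 nE2]] := mn _ mB.
  apply: (le_trans _ (ler_norm _)).
  have := @haar_cellwise_ge R (block_coef w) shifted_lev c_itv shifted_lev_ge p s sp m.
  rewrite (block_coef_block _ mb) /shifted_lev (trunc_log_eq _ mb)// -/n.
  by rewrite nE1 nE2.
rewrite -(ler_pM2r D0).
have -> : 2 ^+ i * w ^+ i * D = 4 * (2 ^+ i * (w ^+ i * D / 4)) by field.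
by apply: (le_trans (ler_wpM2l (ler0n R 4) low)); rewrite !mulrA.
Qed.

End Spread.

(* Conversely, all the cells of a block are on a single level of the square
   grid, but have the sizes of pairwise distinct dyadic levels. *)
Definition gathered_lev (m : nat) : nat := (2 ^ (trunc_log 2 m).+1 + 2)%N.

Lemma gathered_lev_ge m : (m.+2 <= gathered_lev m)%N.
Proof.
rewrite /gathered_lev; case: m => [|m]; first by rewrite trunc_log0.
have /andP[] := @mem_block m.+1 isT; lia.
Qed.

(** * The case [q < r < p]: one block per level of the square grid *)

Section Gather.
Variables (p s q r : R).
Hypotheses (q1 : 1 <= q) (s0 : 0 < s) (sp : s < p^-1) (qr : q < r) (rp : r < p).

Let w := 2 `^ (- r^-1).
Let q0 : 0 < q. Proof. exact: lt_le_trans q1. Qed.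
Let r0 : 0 < r. Proof. exact: lt_trans qr. Qed.
Let p0 : 0 < p. Proof. exact: lt_trans rp. Qed.
Let p1 : 1 <= p. Proof. by rewrite (le_trans q1)// ltW// (lt_trans qr). Qed.
Let w01 : 0 <= w < 1. Proof. by apply: powR2N_itv; rewrite invr_gt0. Qed.
Let w0 : 0 <= w. Proof. by case/andP: w01. Qed.
Let c_itv : forall m, 0 <= block_coef w m <= 1.
Proof. by apply: block_coef_itv; rewrite w0/= ltW//; case/andP: w01. Qed.
Let c0 : block_coef w 0 = 0. Proof. by []. Qed.
Let C := coef_sum p (square_grid R) (cell_coef (block_coef w) gathered_lev).

(** Block [i] fills the level [2 ^ (i + 1) + 2], with at most [2 ^ i] coefficients, all equal to
    [w ^ i]. *)
Let coef_sum_cases k : C k = 0 \/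
  exists i, [/\ (2 ^ i.+1 + 2 = k)%N, (i <= k)%N & C k <= (2 * w `^ p) ^+ i].
Proof.
have H := coef_sum_cell_coef_le c_itv gathered_lev_ge p1 k.
have [[i ik]|none] := pselect (exists i, (2 ^ i.+1 + 2 = k)%N); last first.
  left; apply/eqP; rewrite eq_le coef_sum_ge0 andbT (le_trans H)// big1// => m /eqP mk.
  by exfalso; apply: none; exists (trunc_log 2 m).
right; exists i; split => //.
  by rewrite -ik (leq_trans (ltnW (ltnW (ltn_expl i.+1 (isT : (1 < 2)%N)))))// leq_addr.
apply: (le_trans H).
apply: (@le_trans _ _ (\sum_(m < k) (if (2 ^ i <= m < 2 ^ i.+1)%N
    then (w ^+ i) `^ p else 0))).
  rewrite big_mkcond/=; apply: ler_sum => m _; case: eqP => [mk|_]; last first.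
    by case: ifP => // _; exact: powR_ge0.
  have [->|m0] := posnP m.
    by rewrite c0 powR0 ?gt_eqF//; case: ifP => // _; exact: powR_ge0.
  have mt := mem_block m0.
  have ti : trunc_log 2 m = i.
    have : gathered_lev m = (2 ^ i.+1 + 2)%N by rewrite mk ik.
    rewrite /gathered_lev => /eqP.
    by rewrite eqn_add2r eqn_exp2l// => /eqP [].
  by rewrite ti in mt; rewrite mt (block_coef_block _ mt).
rewrite -big_mkcond/= -(big_mkord (fun m => 2 ^ i <= m < 2 ^ i.+1)%N
  (fun=> (w ^+ i) `^ p)) big_const_seq iter_addr addr0 -[leLHS]mulr_natl exprMn.
rewrite exprn_powR// ler_wpM2r ?exprn_ge0 ?powR_ge0// -natrX ler_nat -size_filter.
rewrite -[leqRHS](size_iota (2 ^ i)); apply: uniq_leq_size.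
  by rewrite filter_uniq// iota_uniq.
move=> m; rewrite mem_filter mem_iota => /andP[+ _].
by rewrite expnS mul2n -addnn.
Qed.

(** The level sums are at most the powers of [2 w ^ p = 2 ^ (1 - p/r)], less than 1 because [r < p];
    raised to the power [q / p] they remain geometric. *)
Let coef_norm_fin : (coef_norm p q%:E (square_grid R)
  (cell_coef (block_coef w) gathered_lev) < +oo)%E.
Proof.
have tE : (2 * w `^ p) `^ (q / p) = 2 `^ (- ((p / r - 1) * (q / p))) :> R.
  rewrite /w -powRrM -{1}(@powRr1 _ 2)// -powRD; last by rewrite pnatr_eq0 implybT.
  by rewrite -powRrM; congr (_ `^ _); ring.
have t01 : 0 <= (2 * w `^ p) `^ (q / p) < 1.
  rewrite tE; apply: powR2N_itv.
  by rewrite mulr_gt0 ?divr_gt0// subr_gt0 ltr_pdivlMr// mul1r.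
have t0 : 0 <= 2 * w `^ p by rewrite mulr_ge0// powR_ge0.
apply: (@coef_norm_lty p q _ _ (1 - (2 * w `^ p) `^ (q / p))^-1) => // N.
apply: (@le_trans _ _ (\sum_(i < N) ((2 * w `^ p) `^ (q / p)) ^+ i)); last first.
  exact: sum_geometric_le.
apply: (@sum_sparse_le (fun k => C k `^ (q / p))
  (fun i => ((2 * w `^ p) `^ (q / p)) ^+ i)
  (fun i => 2 ^ i.+1 + 2)%N N) => [i|k]; first by rewrite exprn_ge0// powR_ge0.
have [Ck0|[i [ik ki le]]] := coef_sum_cases k.
  by left; rewrite Ck0 powR0// mulf_neq0 ?invr_eq0// gt_eqF.
right; exists i; split => //.
rewrite -exprn_powR//.
apply: ge0_ler_powR; rewrite ?nnegrE ?coef_sum_ge0 ?exprn_ge0//.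
by rewrite divr_ge0// ltW.
Qed.

(** Block [i] now yields one Haar coefficient on each of [2 ^ i] consecutive levels, of normalized
    size at least [w ^ i / 4]. Their sum is at least of order [2 ^ (i (1 - 1/r))], whereas
    [besov_haar_diagonal_le] allows [2 ^ (i (1 - 1/q))]; since [q < r], this fails for large [i]. *)
Lemma square_grid_not_besov_gt :
  exists2 f, besov_grid s p q%:E (square_grid R) f & ~ besov s p q%:E f.
Proof.
pose g := cellwise gathered_lev (heights (block_coef w) gathered_lev p s xpredT).
exists (fun x => (g x)%:C).
  exact (@besov_grid_cellwise R (block_coef w) gathered_lev c0 c_itv
    gathered_lev_ge p s p1 s0 q%:E coef_norm_fin).
move=> /(besov_haar_diagonal_le p1 q1 s0)[B B0 HB].
have e0 : 0 < q^-1 - r^-1 by rewrite subr_gt0 ltf_pV2.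
have [i /negP] : exists i, ~~ ((2 `^ (q^-1 - r^-1)) ^+ i <= 4 * B).
  by have [i Hi] := powR2X_unbounded (4 * B) e0; exists i; rewrite -ltNge.
apply; apply: powR2_block_growth.
set y := (2 ^ i)%N; pose n0 := (2 ^ i.+1 + y)%N.
have y2 : (2 ^ i.+1 = y + y)%N by rewrite expnS mul2n -addnn.
have iy : (i < y)%N by rewrite ltn_expl.
(* Below [n0] the position 0 is a default that keeps [ix n < 2 ^ n]. *)
pose ix n := if (n < n0)%N then 0%N else (2 ^ (2 ^ i.+1 - (n - 2 ^ i.+1)))%N.
have ixn n : (ix n < 2 ^ n)%N.
  rewrite /ix; case: ifP => [_|/negbT]; first by rewrite expn_gt0.
  rewrite -leqNgt => h; rewrite ltn_exp2l// (leq_ltn_trans (leq_subr _ _))//.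
  by apply: leq_trans h; rewrite /n0 -[ltnLHS]addn0 ltn_add2l expn_gt0.
have H := HB n0 y ix ixn.
have low : 2 ^+ i * (w ^+ i / 4) <= B * y%:R `^ (1 - q^-1).
  apply: le_trans H.
  have -> : 2 ^+ i * (w ^+ i / 4) = \sum_(n0 <= n < n0 + y) (w ^+ i / 4).
    by rewrite sumr_const_nat addKn -[RHS]mulr_natl natrX.
  rewrite !big_nat; apply: ler_sum => n /andP[n0n nn].
  have [|mb nE1 nE2] := gather_lev y2 (n := n); first by rewrite n0n.
  have := @haar_cellwise_ge R (block_coef w) gathered_lev c_itv gathered_lev_ge
    p s sp (n - 2 ^ i.+1)%N.
  rewrite (block_coef_block _ mb) /gathered_lev (trunc_log_eq _ mb)// nE1 nE2.
  rewrite /ix ltnNge n0n/= => h.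
  have d0 : 0 < 2 ^- n :> R by rewrite invr_gt0 exprn_gt0.
  apply: (le_trans _ (ler_wpM2l (powR_ge0 _ _) (le_trans h (ler_norm _)))).
  rewrite powRN; have := powR_gt0 (1 + (s - p^-1)) d0.
  move: (_ `^ (1 + _)) => d d_gt0.
  by have -> : d^-1 * (w ^+ i * d / 4) = w ^+ i / 4 by field; rewrite gt_eqF.
have -> : 2 ^+ i * w ^+ i = 4 * (2 ^+ i * (w ^+ i / 4)) by field.
by apply: (le_trans (ler_wpM2l (ler0n R 4) low)); rewrite !mulrA.
Qed.

End Gather.

End Cases.

Unset Implicit Arguments.

Theorem proposition7p2 (R : realType) (p s : R) (q : \bar R)
    (hp : 1 <= p) (hq : (1 <= q)%E) (hpq : p%:E <> q)
    (hs : 0 < s < p^-1) :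
  exists P : nat -> set (set R),
    quasisymmetric_grid P /\ besov_grid s p q P <> besov s p q.
Proof.
have /andP[s0 sp] := hs.
exists (square_grid R); split; first exact: quasisymmetric_square_grid.
suff [f fP fD] : exists2 f, besov_grid s p q (square_grid R) f & ~ besov s p q f.
  move=> /seteqP[H _]; exact (fD (H f fP)).
(* The exponent [r] strictly between [p] and [q] is [p + 1] when [q] is infinite and the midpoint
   otherwise. *)
case: q hq hpq => [q||//] hq hpq; last first.
  by apply: (@square_grid_not_besov_lt _ p s (p + 1)); rewrite ?ltry ?ltrDl.
rewrite lee_fin in hq.
have [pq|qp|pq] := ltgtP p q; last by rewrite pq in hpq.
  apply: (@square_grid_not_besov_lt _ p s ((p + q) / 2)) => //; rewrite ?lte_fin; lra.
by apply: (@square_grid_not_besov_gt _ p s q ((p + q) / 2)) => //; lra.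
Qed.
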